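(* Let $\{(x^k,\epsilon^k)\}_{k\in\mathbb{N}}$ be the (infinite) sequence generated by Algorithm IReNA (described in the context, run with tolerance $\tau=0$) under the standing assumptions in the context. Then $$\lim_{k\to+\infty}\|x^{k+1}-x^k\|=0\quad\text{and}\quad \lim_{k\to+\infty}\|\epsilon^{k+1}-\epsilon^k\|=0.$$ Moreover, $$\lim_{k\to+\infty}\|\Phi(x^k;\epsilon^k)\|=0\quad\text{and}\quad \lim_{k\to+\infty}\|\Psi(x^k;\epsilon^k)\|=0.$$ Furthermore, let $\chi^\infty$ be the set of all cluster points of $\{x^k\}$. Then any $x^*\in\chi^\infty$ satisfies the first-order stationarity condition $$0\in\nabla_i f(x^* )+\lambda\,\partial r(|x_i^*|),\qquad \forall i\in[n].$$
   Context: **Problem.** $[n]=\{1,\dots,n\}$, $\|\cdot\|$ is the $\ell_2$ norm. $\lambda>0$; $f:\mathbb{R}^n\to\mathbb{R}$ is twice continuously differentiable (possibly nonconvex); $r:\mathbb{R}\to[0,\infty)$ is $C^2$ on $\mathbb{R}\setminus\{0\}$ with $r(0)=0$, $r'(t)>0$ and $r''(t)\le 0$ for $t>0$; $r'(0^+)=\lim_{t\downarrow0}r'(t)\in(0,+\infty]$. The problem is to minimize $F(x):=f(x)+\lambda\sum_{i=1}^n r(|x_i|)$. For $\epsilon\in\mathbb{R}^n$, $\epsilon\ge 0$, put $F(x;\epsilon):=f(x)+\lambda\sum_{i=1}^n r(|x_i|+\epsilon_i)$ (so $F(x)=F(x;0)$), and weights $\omega_i=\omega(x_i,\epsilon_i):=\lambda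 r'(|x_i|+\epsilon_i)$; $\omega_i^k:=\omega(x_i^k,\epsilon_i^k)$. $\partial r(|x_i|)$ denotes the subdifferential of $t\mapsto r(|t|)$ at $t=x_i$: it is $\{r'(|x_i|)\,\mathrm{sgn}(x_i)\}$ if $x_i\ne0$, and $[-r'(0^+),r'(0^+)]$ (equal to $\mathbb{R}$ if $r'(0^+)=+\infty$) if $x_i=0$. **Notation.** $\mathcal{I}(x)=\{i: x_i\neq0\}$, $\mathcal{I}_0(x)=\{i:x_i=0\}$, $\mathcal{I}_+(x)=\{i:x_i>0\}$, $\mathcal{I}_-(x)=\{i:x_i<0\}$; $\mathcal{I}^k=\mathcal{I}(x^k)$, $\mathcal{I}_0^k=\mathcal{I}_0(x^k)$. $\mathrm{sgn}$ acts componentwise with $\mathrm{sgn}(0)=0$. For $\mathcal{S}\subseteq[n]$, $x_{\mathcal{S}}$ is the subvector indexed by $\mathcal{S}$. For $\mathcal{S}\subseteq\mathcal{I}(x)$, $\nabla_{\mathcal{S}}F(x;\epsilon)$ and $\nabla^2_{\mathcal{S}\mathcal{S}}F(x;\epsilon)$ are the gradient and Hessian with respect to $x_{\mathcal{S}}$; thus $\nabla_iF(x;\epsilon)=\nabla_if(x)+\omega_i\,\mathrm{sgn}(x_i)$ for $i\in\mathcal{I}(x)$. Soft-thresholding: $[\mathbb{S}_\omega(v)]_i=\mathrm{sgn}(v_i)\max(|v_i|-\omega_i,0)$. Orthant projection: $[\mathbb{P}(y;x)]_i=\mathrm{sgn}(x_i)\max\{0,\mathrm{sgn}(x_i)y_i\}$.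 **Residuals.** $[\Psi(x;\epsilon)]_i=\nabla_if(x)+\omega_i$ if $i\in\mathcal{I}_0(x)$ and $\nabla_if(x)+\omega_i<0$; $=\nabla_if(x)-\omega_i$ if $i\in\mathcal{I}_0(x)$ and $\nabla_if(x)-\omega_i>0$; $=0$ otherwise. $[\Phi(x;\epsilon)]_i=0$ if $i\in\mathcal{I}_0(x)$; $=\min\{\nabla_if(x)+\omega_i,\max\{x_i,\nabla_if(x)-\omega_i\}\}$ if $i\in\mathcal{I}_+(x)$ and $\nabla_if(x)+\omega_i>0$; $=\max\{\nabla_if(x)-\omega_i,\min\{x_i,\nabla_if(x)+\omega_i\}\}$ if $i\in\mathcal{I}_-(x)$ and $\nabla_if(x)-\omega_i<0$; $=\nabla_if(x)+\omega_i\,\mathrm{sgn}(x_i)$ otherwise. Write $\Psi^k=\Psi(x^k;\epsilon^k)$, $\Phi^k=\Phi(x^k;\epsilon^k)$. Also $G_k(x):=f(x)+\sum_{i=1}^n\omega_i^k|x_i|$. **Algorithm IReNA.** Inputs: $x^0\in\mathbb{R}^n$, $\epsilon^0\in\mathbb{R}^n_{++}$, $\eta_\Phi,\eta_\Psi\in(0,1]$, $\gamma_\epsilon,\gamma_\beta,\gamma_\alpha\in(0,1)$, $\eta,\xi_\beta,\xi_\alpha,\bar\beta,\nu\in(0,\infty)$, regularization parameters $\zeta_k\in(0,\infty)$, tolerance $\tau\geq 0$. For $k=0,1,2,\dots$: 1. Stop if $\max\{\|\Psi^k\|,\|\Phi^k\|\}\le\tau$ and $\epsilon_i^k\le\tau$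 for all $i\in\mathcal{I}^k$. 2. (Subspace) Choose $\mathcal{W}_k$: if $\|\Psi^k\|\ge\eta\|\Phi^k\|$, then $\mathcal{W}_k\subseteq\{i:[\Psi^k]_i\ne0\}$ with $\|[\Psi^k]_{\mathcal{W}_k}\|\ge\eta_\Psi\|\Psi^k\|$; otherwise $\mathcal{W}_k\subseteq\{i:[\Phi^k]_i\ne0\}$ with $\|[\Phi^k]_{\mathcal{W}_k}\|\ge\eta_\Phi\|\Phi^k\|$. 3. (IST step) For $j=0,1,\dots$ with $\beta_j=\bar\beta\gamma_\beta^j$, let $y^j$ agree with $x^k$ off $\mathcal{W}_k$ and $y^j_{\mathcal{W}_k}=[\mathbb{S}_{\beta_j\omega^k}(x^k-\beta_j\nabla f(x^k))]_{\mathcal{W}_k}$; stop at the first $j$ with $G_k(y^j)\le G_k(x^k)-\frac{\xi_\beta}{2}\|y^j-x^k\|^2$, and set $\hat x^k=y^j$, $\hat\beta_k=\beta_j$, $\hat\Delta^k_{\rm IST}=G_k(x^k)-G_k(y^j)$. 4. If $\mathrm{sgn}(\hat x^k)\neq\mathrm{sgn}(x^k)$, set $x^{k+1}=\hat x^k$. If $\mathrm{sgn}(\hat x^k)=\mathrm{sgn}(x^k)$: (a) (QP subproblem) with $g^k=\nabla_{\mathcal{W}_k}F(x^k;\epsilon^k)$, $H^k=\nabla^2_{\mathcal{W}_k\mathcal{W}_k}F(x^k;\epsilon^k)+\zeta_kI\succ0$, $m_k(d)=\langle g^k,d\rangle+\frac12\langle d,H^kd\rangle$ and $d_R^k=-\frac{\|g^k\|^2}{\langle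 g^k,H^kg^k\rangle}g^k$, find $\tilde d^k\in\mathbb{R}^{|\mathcal{W}_k|}$ with $\langle g^k,\tilde d^k\rangle\le\langle g^k,d_R^k\rangle$ and $m_k(\tilde d^k)\le m_k(0)$ (extended by zero off $\mathcal{W}_k$); (b) (Projected line search) start with $\alpha_0=1$ and for $j=0,1,\dots$ let $y^j=\mathbb{P}(x^k+\alpha_j\tilde d^k;x^k)$; the first time that $\mathrm{sgn}(y^j)=\mathrm{sgn}(x^k)$, reset $\alpha_j=\min\{1,\alpha_B\}$ with $\alpha_B=\sup\{\alpha>0:\mathrm{sgn}(x^k+\alpha\tilde d^k)=\mathrm{sgn}(x^k)\}$ and recompute $y^j=\mathbb{P}(x^k+\alpha_j\tilde d^k;x^k)$; stop if $F(y^j;\epsilon^k)\le F(x^k;\epsilon^k)-\frac{\xi_\alpha}{2}\|y^j-x^k\|^2$, else $\alpha_{j+1}=\gamma_\alpha\alpha_j$. On stopping set $\tilde x^k=y^j$, $\tilde\alpha_k=\alpha_j$, $\tilde\Delta^k_{\rm QP}=F(x^k;\epsilon^k)-F(y^j;\epsilon^k)$; (c) if $\mathrm{sgn}(\tilde x^k)\ne\mathrm{sgn}(x^k)$ and $\tilde\Delta^k_{\rm QP}<\nu\hat\Delta^k_{\rm IST}$, set $x^{k+1}=\hat x^k$; otherwise set $x^{k+1}=\tilde x^k$. 5. Choose $\epsilon_i^{k+1}\in(0,\gamma_\epsilon\epsilon_i^k)$ for $i\in\mathcal{I}^{k+1}$ and set $\epsilon_i^{k+1}=\epsilon_i^k$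 for $i\in\mathcal{I}_0^{k+1}$; update $\omega_i^{k+1}=\lambda r'(|x_i^{k+1}|+\epsilon_i^{k+1})$. **Standing assumption.** $\tau=0$, and the level set $\mathrm{Lev}_F:=\{x:F(x)\le F(x^0;\epsilon^0)\}$ is contained in a bounded ball $\{x:\|x\|\le R\}$, so that $F$ is bounded below and $\nabla f$ is Lipschitz on $\mathrm{Lev}_F$ with constant $L_f>0$.
   Formalization: The formal theorem also assumes constants 0 < μ and M with μI ⪯ H^k ⪯ MI on the variables W_k at every iteration that solves the QP subproblem; with arbitrary ζ_k > 0 and only H^k ≻ 0 the claim fails. *)

(* Defs.v *)
(* MathComp-Analysis. *)
From mathcomp Require Import all_boot all_order all_algebra.
From mathcomp Require Import all_classical all_reals all_analysis.
Import Order.TTheory GRing.Theory Num.Theory.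
Import numFieldNormedType.Exports.

Local Open Scope ring_scope.
Local Open Scope classical_set_scope.

Section Vectors.
Context {R : realType} {n : nat}.
Implicit Types (u v x y : 'rV[R]_n) (W : {set 'I_n}).

Definition dot u v : R := \sum_(i < n) u 0 i * v 0 i.

(* The library norm `|x| on 'rV[R]_n is the sup norm; this is the l2 norm. *)
Definition norm2 u : R := Num.sqrt (dot u u).

Definition sgnv x : 'rV[R]_n := \row_i Num.sg (x 0 i).

(* The subvector x_W is encoded by its extension by zero off W. *)
Definition subvec W x : 'rV[R]_n := \row_i (if i \in W then x 0 i else 0).

Definition partial (h : 'rV[R]_n -> R) (i : 'I_n) x : R :=
  'D_(delta_mx 0 i) h x.

Definition grad (h : 'rV[R]_n -> R) x : 'rV[R]_n := \row_i partial h i x.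

Definition C2 (h : 'rV[R]_n -> R) : Prop :=
  [/\ forall x, differentiable h x,
      forall x, differentiable (grad h) x
    & continuous (fun x => 'J (grad h) x)].

Definition soft (w v : 'rV[R]_n) : 'rV[R]_n :=
  \row_i (Num.sg (v 0 i) * Num.max (`|v 0 i| - w 0 i) 0).

Definition orthant_proj y x : 'rV[R]_n :=
  \row_i (Num.sg (x 0 i) * Num.max 0 (Num.sg (x 0 i) * y 0 i)).

End Vectors.

Section Regularizer.
Context {R : realType}.
Variable r : R -> R.

Definition regularizer : Prop :=
  [/\ forall t : R, 0 <= r t,
      r 0 = 0,
      forall t : R, t != 0 ->
        [/\ derivable r t 1, derivable (derive1 r) t 1
          & {for t, continuous (derive1 (derive1 r))}],
      forall t : R, 0 < t -> 0 < derive1 r t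
    & forall t : R, 0 < t -> derive1 (derive1 r) t <= 0].

Definition dr0 : \bar R := lim ((derive1 r t)%:E @[t --> 0^'+]).

(* The subdifferential of t |-> r |t|. *)
Definition subdiff (t : R) : set R :=
  if t == 0 then [set s | (- dr0 <= s%:E)%E /\ (s%:E <= dr0)%E]
  else [set derive1 r `|t| * Num.sg t].

End Regularizer.

Section Objective.
Context {R : realType} {n : nat}.
Variables (lam : R) (f : 'rV[R]_n -> R) (r : R -> R).
Implicit Types (x y e : 'rV[R]_n) (W : {set 'I_n}).

Definition Feps e x : R := f x + lam * \sum_(i < n) r (`|x 0 i| + e 0 i).

Definition F x : R := Feps 0 x.

Definition weight x e : 'rV[R]_n :=
  \row_i (lam * derive1 r (`|x 0 i| + e 0 i)).

Definition Psi x e : 'rV[R]_n :=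
  \row_i (let g := partial f i x in
          let w := weight x e 0 i in
          if x 0 i == 0 then
            if g + w < 0 then g + w
            else if 0 < g - w then g - w
            else 0
          else 0).

Definition Phi x e : 'rV[R]_n :=
  \row_i (let g := partial f i x in
          let w := weight x e 0 i in
          let xi := x 0 i in
          if xi == 0 then 0
          else if (0 < xi) && (0 < g + w) then
            Num.min (g + w) (Num.max xi (g - w))
          else if (xi < 0) && (g - w < 0) then
            Num.max (g - w) (Num.min xi (g + w))
          else g + w * Num.sg xi).

(* [Gmodel xk ek] is the weighted-l1 model with weights frozen at (xk, ek). *)
Definition Gmodel xk ek x : R :=
  f x + \sum_(i < n) weight xk ek 0 i * `|x 0 i|.

Definition level_set x0 e0 : set 'rV[R]_n := [set x | F x <= Feps e0 x0].

Definition standing_assumption x0 e0 (rad Lf : R) : Prop :=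
  [/\ forall x, level_set x0 e0 x -> norm2 x <= rad,
      exists m : R, forall x, m <= F x,
      0 < Lf
    & forall x y, level_set x0 e0 x -> level_set x0 e0 y ->
        norm2 (grad f x - grad f y) <= Lf * norm2 (x - y)].

Definition stationary x : Prop :=
  forall i : 'I_n,
    [set partial f i x + lam * s | s in subdiff r (x 0 i)] 0.

End Objective.

Record irena_params (R : realType) := IrenaParams {
  eta_Phi : R; eta_Psi : R;
  gam_eps : R; gam_beta : R; gam_alpha : R;
  eta : R; xi_beta : R; xi_alpha : R; beta_bar : R; nu : R;
  zeta : nat -> R }.

Arguments eta_Phi {R}. Arguments eta_Psi {R}.
Arguments gam_eps {R}. Arguments gam_beta {R}. Arguments gam_alpha {R}.
Arguments eta {R}. Arguments xi_beta {R}. Arguments xi_alpha {R}.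
Arguments beta_bar {R}. Arguments nu {R}. Arguments zeta {R}.

Definition admissible {R : realType} (P : irena_params R) : Prop :=
  [/\ (0 < eta_Phi P <= 1) /\ (0 < eta_Psi P <= 1),
      [/\ 0 < gam_eps P < 1, 0 < gam_beta P < 1 & 0 < gam_alpha P < 1],
      [/\ 0 < eta P, 0 < xi_beta P & 0 < xi_alpha P],
      0 < beta_bar P /\ 0 < nu P
    & forall k, 0 < zeta P k].

Section Irena.
Context {R : realType} {n : nat}.
Variables (lam : R) (f : 'rV[R]_n -> R) (r : R -> R) (P : irena_params R).
Implicit Types (x y e d xhat xt xnext enext : 'rV[R]_n) (W : {set 'I_n}).

Local Notation Fe := (Feps lam f r).
Local Notation Psi := (Psi lam f r).
Local Notation Phi := (Phi lam f r).
Local Notation G := (Gmodel lam f r).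

Definition stop_test (tau : R) x e : Prop :=
  Num.max (norm2 (Psi x e)) (norm2 (Phi x e)) <= tau /\
  (forall i, x 0 i != 0 -> e 0 i <= tau).

Definition working_set x e W : Prop :=
  if eta P * norm2 (Phi x e) <= norm2 (Psi x e) then
    (forall i, i \in W -> Psi x e 0 i != 0) /\
    eta_Psi P * norm2 (Psi x e) <= norm2 (subvec W (Psi x e))
  else
    (forall i, i \in W -> Phi x e 0 i != 0) /\
    eta_Phi P * norm2 (Phi x e) <= norm2 (subvec W (Phi x e)).

Definition ist_trial x e W (j : nat) : 'rV[R]_n :=
  let beta := beta_bar P * gam_beta P ^+ j in
  \row_i (if i \in W then
            soft (beta *: weight lam r x e) (x - beta *: grad f x) 0 i
          else x 0 i).

Definition ist_accept x e W (j : nat) : Prop :=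
  let y := ist_trial x e W j in
  G x e y <= G x e x - xi_beta P / 2 * norm2 (y - x) ^+ 2.

Definition ist_step x e W xhat : Prop :=
  exists j, [/\ ist_accept x e W j,
                forall i, (i < j)%N -> ~ ist_accept x e W i
              & xhat = ist_trial x e W j].

(* Gradient and Hessian of F(.;e) in the variables W, extended by zero. *)
Definition qp_grad x e W : 'rV[R]_n :=
  subvec W (grad (Fe e) x).

Definition qp_hess (z : R) x e W : 'M[R]_n :=
  \matrix_(i, j) (if (i \in W) && (j \in W) then
                    partial (partial (Fe e) j) i x + z * (i == j)%:R
                  else 0).

Definition qform (H : 'M[R]_n) d : R := dot d (d *m H).

Definition supported W d : Prop := forall i, i \notin W -> d 0 i = 0.

Definition qp_posdef (z : R) x e W : Prop :=
  forall d, supported W d -> d != 0 -> 0 < qform (qp_hess z x e W) d.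

Definition qp_model (z : R) x e W d : R :=
  dot (qp_grad x e W) d + qform (qp_hess z x e W) d / 2.

(* When the gradient vanishes, 0 / 0 = 0 makes the reference direction 0. *)
Definition qp_ref (z : R) x e W : 'rV[R]_n :=
  let g := qp_grad x e W in
  - (norm2 g ^+ 2 / qform (qp_hess z x e W) g) *: g.

Definition qp_direction (z : R) x e W d : Prop :=
  [/\ supported W d,
      dot (qp_grad x e W) d <= dot (qp_grad x e W) (qp_ref z x e W)
    & qp_model z x e W d <= qp_model z x e W 0].

Definition alpha_B x d : \bar R :=
  ereal_sup [set a%:E | a in
    [set a : R | 0 < a /\ sgnv (x + a *: d) = sgnv x]].

Definition ls_point x d (a : R) : 'rV[R]_n := orthant_proj (x + a *: d) x.

(* State at trial j: the step size actually tested, and whether the one-time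
   reset to min{1, alpha_B} has already taken place. *)
Fixpoint ls_state x d (j : nat) : R * bool :=
  let: (a, was_reset) :=
    if j is j'.+1 then
      (gam_alpha P * (ls_state x d j').1, (ls_state x d j').2)
    else (1, false) in
  if ~~ was_reset && (sgnv (ls_point x d a) == sgnv x) then
    (fine (Order.min 1%:E (alpha_B x d)), true)
  else (a, was_reset).

Definition ls_trial x d (j : nat) : 'rV[R]_n :=
  ls_point x d (ls_state x d j).1.

Definition ls_accept x e d (j : nat) : Prop :=
  let y := ls_trial x d j in
  Fe e y <= Fe e x - xi_alpha P / 2 * norm2 (y - x) ^+ 2.

Definition line_search x e d xt : Prop :=
  exists j, [/\ ls_accept x e d j,
                forall i, (i < j)%N -> ~ ls_accept x e d i
              & xt = ls_trial x d j].

Definition next_iterate (z : R) x e W xhat xnext : Prop :=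
  if sgnv xhat != sgnv x then xnext = xhat
  else
    qp_posdef z x e W /\
    exists d xt, [/\ qp_direction z x e W d, line_search x e d xt
      & xnext =
          if (sgnv xt != sgnv x) &&
             (Fe e x - Fe e xt < nu P * (G x e x - G x e xhat))
          then xhat else xt].

Definition eps_update e xnext enext : Prop :=
  forall i, (xnext 0 i != 0 -> 0 < enext 0 i < gam_eps P * e 0 i) /\
            (xnext 0 i = 0 -> enext 0 i = e 0 i).

(* An infinite run: the stopping test fails at every iteration, and both
   backtracking loops of every iteration terminate. *)
Definition irena_run (tau : R) (x e : nat -> 'rV[R]_n)
    (W : nat -> {set 'I_n}) (xhat : nat -> 'rV[R]_n) : Prop :=
  (forall i, 0 < e 0%N 0 i) /\
  forall k,
    [/\ ~ stop_test tau (x k) (e k),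
        working_set (x k) (e k) (W k),
        ist_step (x k) (e k) (W k) (xhat k),
        next_iterate (zeta P k) (x k) (e k) (W k) (xhat k) (x k.+1)
      & eps_update (e k) (x k.+1) (e k.+1)].

(* mu I <= H^k <= M I at every iteration that solves a QP subproblem.
   Positive definiteness of each H^k separately does not suffice: with
   sum_k 1 / zeta_k finite (no M), or with sum_k (sqrt zeta_k) finite and a
   singular Hessian of F (no mu), the QP steps can be summable and the
   iterates converge to a nonstationary point. *)
Definition qp_hess_bounded (mu M : R) (x e : nat -> 'rV[R]_n)
    (W : nat -> {set 'I_n}) (xhat : nat -> 'rV[R]_n) : Prop :=
  forall k, sgnv (xhat k) = sgnv (x k) ->
  forall d, supported (W k) d ->
    mu * norm2 d ^+ 2 <= qform (qp_hess (zeta P k) (x k) (e k) (W k)) d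
      <= M * norm2 d ^+ 2.

End Irena.

(* Main.v *)
(* By concavity of r, the weighted-l1 model majorizes F(.; eps), so both kinds of
   step decrease the values F(x^k; eps^k), which converge. Everything therefore
   follows from |Phi^k|^2 + |Psi^k|^2 <= C (F(x^k; eps^k) - F(x^k+1; eps^k+1)).
   An IST step has a stepsize bounded below, and its displacement dominates the
   residual on the working set, hence both residuals. When a QP step changes the
   sign pattern, the test in step 4(c) compares its decrease with that of the IST
   step. When it does not, the IST displacement is -beta times the QP gradient,
   whose entries are thus bounded even where the weights are unbounded; since r
   is concave, the curvature of F(.; eps) along the direction is bounded above by
   that of f alone, uniformly in eps, so the QP stepsize is bounded below.
   At a cluster point, |grad_i f| <= w_i + |Psi_i| + |Phi_i| gives stationarity at
   zero coordinates; at a nonzero coordinate eps_i tends to 0 and Phi_i is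
   eventually has the modulus of grad_i F(x^k; eps^k). *)
Require Import Defs.
From mathcomp Require Import all_boot all_order all_algebra.
From mathcomp Require Import all_classical all_reals all_analysis.
From mathcomp Require Import ring lra.
Import Order.TTheory GRing.Theory Num.Theory.
Import numFieldNormedType.Exports.

Local Open Scope ring_scope.
Local Open Scope classical_set_scope.

(** * Mean value theorem on a possibly degenerate interval *)

Section MeanValue.
Context {R : realType}.

Lemma MVT_derivable (g dg : R -> R) (a b : R) : a <= b ->
  (forall t, a <= t <= b -> is_derive t 1 g (dg t)) ->
  exists2 c, a <= c <= b & g b - g a = dg c * (b - a).
Proof.
move=> ab dgE.
have [||c + gE] := @MVT_segment R g dg a b ab.
- by move=> t; rewrite in_itv /= => /andP[at_ tb]; apply: dgE; rewrite !ltW.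
- apply: derivable_within_continuous => t; rewrite in_itv /= => tab.
  by have [] := dgE _ tab.
- by rewrite in_itv /= => cab; exists c.
Qed.

End MeanValue.

(** * Monotonicity and concavity of the regularizer *)

Section RegularizerTheory.
Context {R : realType} {r : R -> R} (rP : regularizer r).
Implicit Types a b t : R.

Lemma regularizer_is_derive t : 0 < t -> is_derive t 1 r (derive1 r t).
Proof.
case: rP => _ _ dr _ _ t0; have [d1 _ _] := dr t (lt0r_neq0 t0).
by apply: DeriveDef d1 _; rewrite derive1E.
Qed.

Lemma derive1_regularizer_le a b : 0 < a -> a <= b -> derive1 r b <= derive1 r a.
Proof.
case: rP => _ _ dr _ r2 a0 ab.
have [|c /andP[ac cb] rE] := @MVT_derivable R (derive1 r) (derive1 (derive1 r)) a b ab.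
  move=> t /andP[at_ tb]; have t0 := lt_le_trans a0 at_.
  have [_ d2 _] := dr t (lt0r_neq0 t0).
  by apply: DeriveDef d2 _; rewrite derive1E.
rewrite -subr_le0 rE mulr_le0_ge0 ?subr_ge0 //.
exact/r2/(lt_le_trans a0).
Qed.

(** Concavity away from 0: the slope at the intermediate point is compared with the slope at [a], as
    [derive1 r] is nonincreasing. This is the source of the weighted-l1 majorization. *)
Lemma regularizer_tangent a b : 0 < a -> 0 < b ->
  r b - r a <= derive1 r a * (b - a).
Proof.
move=> a0 b0; have [ab|/ltW ba] := leP a b.
  have [t /andP[at_ _]|c /andP[ac cb] ->] := @MVT_derivable R r (derive1 r) a b ab.
    exact/regularizer_is_derive/(lt_le_trans a0).
  by rewrite ler_wpM2r ?subr_ge0 // derive1_regularizer_le.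
have [t /andP[at_ _]|c /andP[ac cb] rE] := @MVT_derivable R r (derive1 r) b a ba.
  exact/regularizer_is_derive/(lt_le_trans b0).
rewrite -lerN2 opprB rE -mulrN opprB ler_wpM2r ?subr_ge0 //.
exact/derive1_regularizer_le/cb/(lt_le_trans b0).
Qed.

Lemma regularizer_le a b : 0 < a -> a <= b -> r a <= r b.
Proof.
move=> a0 ab; have b0 := lt_le_trans a0 ab.
have [_ _ _ r1 _] := rP.
rewrite -subr_le0 (le_trans (regularizer_tangent b a b0 a0)) //.
by rewrite mulr_ge0_le0 ?subr_le0 // ltW // r1.
Qed.

(* [r] may jump at 0, so this is not a limiting case of [regularizer_le]. *)
Lemma regularizer_le0 a b : 0 <= a -> a <= b -> r a <= r b.
Proof.
rewrite le_eqVlt => /predU1P[<- _|]; last exact: regularizer_le.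
by case: rP => r_ge0 -> _ _ _.
Qed.

Lemma derive1_le_dr0 t : 0 < t -> ((derive1 r t)%:E <= dr0 r)%E.
Proof.
move=> t0; rewrite /dr0.
have [_ _ _ r1 _] := rP.
(* By monotonicity the right limit at 0 is the supremum of the values near 0, finite or not. *)
have cv : (derive1 r s)%:E @[s --> 0^'+] -->
    ereal_sup [set (derive1 r s)%:E | s in `]0, t[%classic].
  apply: (@nonincreasing_at_right_cvge R (fun s => (derive1 r s)%:E) 0 (BLeft t)) => //.
  by move=> s u; rewrite !in_itv /= lee_fin => /andP[s0 _] _ su; exact: derive1_regularizer_le.
rewrite (cvg_lim _ cv) //.
(* The interval is open at [t], so the supremum is bounded below through [t / 2]. *)
apply: (@le_trans _ _ (derive1 r (t / 2))%:E).
  by rewrite lee_fin derive1_regularizer_le; lra.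
by apply: ereal_sup_ubound; exists (t / 2) => //=; rewrite in_itv /=; lra.
Qed.

End RegularizerTheory.

(** * Euclidean inner product and norm *)

Section Euclidean.
Context {R : realType} {n : nat}.
Implicit Types u v w : 'rV[R]_n.

Lemma dotC u v : dot u v = dot v u.
Proof. by apply: eq_bigr => i _; rewrite mulrC. Qed.

Lemma dotDl u v w : dot (u + v) w = dot u w + dot v w.
Proof. by rewrite -big_split; apply: eq_bigr => i _; rewrite mxE mulrDl. Qed.

Lemma dotZl a u v : dot (a *: u) v = a * dot u v.
Proof. by rewrite mulr_sumr; apply: eq_bigr => i _; rewrite mxE mulrA. Qed.

Lemma dotDr u v w : dot w (u + v) = dot w u + dot w v.
Proof. by rewrite !(dotC w) dotDl. Qed.

Lemma dotZr a u v : dot u (a *: v) = a * dot u v.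
Proof. by rewrite !(dotC u) dotZl. Qed.

Lemma dot_ge0 u : 0 <= dot u u.
Proof. by apply: sumr_ge0 => i _; rewrite -expr2 sqr_ge0. Qed.

Lemma dot_ge_coord u i : u 0 i ^+ 2 <= dot u u.
Proof.
rewrite /dot (bigD1 i) //= -expr2 lerDl.
by apply: sumr_ge0 => j _; rewrite -expr2 sqr_ge0.
Qed.

Lemma norm2_sqr u : norm2 u ^+ 2 = dot u u.
Proof. by rewrite sqr_sqrtr // dot_ge0. Qed.

Lemma norm2_ge0 u : 0 <= norm2 u.
Proof. exact: sqrtr_ge0. Qed.

Lemma norm2_ge_coord u i : `|u 0 i| <= norm2 u.
Proof.
by rewrite -sqrtr_sqr ler_sqrt ?dot_ge0 ?dot_ge_coord.
Qed.

(** Expand the squared norm of [a *: u - v] and divide by [a]. *)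
Lemma dot_young (a : R) u v : 0 < a ->
  2 * dot u v <= a * dot u u + a^-1 * dot v v.
Proof.
move=> a0.
have := dot_ge0 (a *: u - v).
rewrite -[- v]scaleN1r !(dotDl, dotDr, dotZl, dotZr) (dotC v u) => h.
have -> : a * dot u u + a^-1 * dot v v = a^-1 * (a * (a * dot u u) + dot v v).
  by rewrite mulrDr mulKf ?gt_eqF.
rewrite -ler_pdivrMl ?invr_gt0 // invrK; lra.
Qed.

End Euclidean.

(** Compact convex sets that also hold the trial points, which may leave the level set; uniform
    bounds on the derivatives of [f] are taken over them. *)
Definition box {R : realType} {n : nat} (rho : R) : set 'rV[R]_n :=
  [set x | forall i, `|x 0 i| <= rho].

(** * Compactness of boxes and derivatives along lines *)

Section Descent.
Context {R : realType} {n : nat}.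
Implicit Types (x y v : 'rV[R]_n) (h f : 'rV[R]_n -> R) (rho : R).

Lemma box_compact rho : compact (@box R n rho).
Proof.
have -> : @box R n rho =
    [set v : 'rV[R]_n | forall i, (`[- rho, rho]%classic) (v ord0 i)].
  by apply/seteqP; split => v /= bv i; have := bv i;
    rewrite in_itv /= ler_norml.
exact: (@rV_compact _ _ (fun=> `[- rho, rho]%classic) (fun=> @segment_compact R _ _)).
Qed.

Lemma box_segment rho x y (t : R) : box rho x -> box rho y -> 0 <= t <= 1 ->
  box rho (x + t *: (y - x)).
Proof.
move=> bx by_ /andP[t0 t1] i; rewrite !mxE; have := bx i; have := by_ i.
rewrite !ler_norml => /andP[? ?] /andP[? ?]; apply/andP; split; nra.
Qed.

Lemma continuous_box_bounded h rho : continuous h ->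
  exists2 K : R, 0 <= K & forall x, box rho x -> `|h x| <= K.
Proof.
move=> hc; have : compact (h @` box rho).
  by apply: continuous_compact (box_compact rho); exact: continuous_subspaceT.
move=> /compact_bounded/ex_strict_bound_gt0[K /ltW K0 hK].
by exists K => // x bx; apply/ltW/hK; exists x.
Qed.

Lemma derive_dot h x v : differentiable h x -> 'D_v h x = dot (grad h x) v.
Proof.
move=> dh; rewrite deriveE // [in LHS](row_sum_delta v) linear_sum.
by apply: eq_bigr => i _; rewrite linearZ /= mxE /partial deriveE // mulrC.
Qed.

Lemma is_derive_line (V : normedModType R) (h : 'rV[R]_n -> V) x v (t : R) :
  derivable h (x + t *: v) v ->
  is_derive t 1 (fun s => h (x + s *: v)) ('D_v h (x + t *: v)).
Proof.
move=> dh.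
have E : (fun s : R => s^-1 *: (h (x + (s *: 1 + t) *: v) - h (x + t *: v))) =
         (fun s : R => s^-1 *: (h (s *: v + (x + t *: v)) - h (x + t *: v))).
  apply/funext => s; congr (_ *: (h _ - _)).
  by rewrite [s%:A](mulr1) scalerDl addrCA.
by apply: DeriveDef; rewrite /derivable /derive /= E.
Qed.

End Descent.

(** * Bounds on a box from the second-order smoothness of [f] *)

Section SecondOrder.
Context {R : realType} {n : nat} {f : 'rV[R]_n -> R} (fC2 : C2 f).
Implicit Types (x y v : 'rV[R]_n) (rho : R).

Lemma grad_continuous i : continuous (fun x => grad f x 0 i).
Proof.
move=> x; apply: (@continuous_comp _ _ _ (grad f) (fun M : 'rV[R]_n => M 0 i)).
  by apply: differentiable_continuous; case: fC2.
exact: coord_continuous.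
Qed.

Lemma grad_bounded rho :
  exists2 K : R, 0 <= K & forall x i, box rho x -> `|partial f i x| <= K.
Proof.
have /choice[K KP] : forall i, exists K : R, 0 <= K /\
    forall x, box rho x -> `|grad f x 0 i| <= K.
  by move=> i; have [K] := continuous_box_bounded _ rho (grad_continuous i); exists K.
exists (\sum_i K i); first by apply: sumr_ge0 => i _; case: (KP i).
move=> x i bx; have := (KP i).2 x bx; rewrite mxE => /le_trans; apply.
by rewrite (bigD1 i) //= lerDl sumr_ge0 // => j _; case: (KP j).
Qed.

Lemma hess_bounded rho : exists2 K : R, 0 <= K &
  forall x v, box rho x -> dot (v *m 'J (grad f) x) v <= K * dot v v.
Proof.
have [_ _ Jc] := fC2.
have /choice[K KP] : forall ij : 'I_n * 'I_n, exists K : R, 0 <= K /\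
    forall x, box rho x -> `|'J (grad f) x ij.1 ij.2| <= K.
  move=> ij.
  have Jij : continuous (fun x => 'J (grad f) x ij.1 ij.2).
    move=> x; apply: (@continuous_comp _ _ _ (fun x => 'J (grad f) x)
      (fun M : 'M[R]_n => M ij.1 ij.2)); [exact: Jc|exact: coord_continuous].
  by have [K] := continuous_box_bounded _ rho Jij; exists K.
have K0 ij := (KP ij).1.
exists (\sum_ij K ij); first exact: sumr_ge0.
move=> x v bx; rewrite mulr_suml.
have -> : dot (v *m 'J (grad f) x) v =
    \sum_(ij : 'I_n * 'I_n) 'J (grad f) x ij.1 ij.2 * (v 0 ij.1 * v 0 ij.2).
  rewrite -(pair_bigA _ (fun i j => 'J (grad f) x i j * (v 0 i * v 0 j))) /=.
  rewrite exchange_big; apply: eq_bigr => j _; rewrite mxE mulr_suml.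
  by apply: eq_bigr => i _; ring.
apply: ler_sum => -[i j] _ /=; apply: le_trans (ler_norm _) _.
rewrite normrM ler_pM //; first exact: ((KP (i, j)).2 x bx).
(* The squares of [v 0 i - v 0 j] and [v 0 i + v 0 j] bound the product of the two entries from both
   sides. *)
have := dot_ge_coord v i; have := dot_ge_coord v j.
have := sqr_ge0 (v 0 i - v 0 j); have := sqr_ge0 (v 0 i + v 0 j).
by rewrite ler_norml => *; apply/andP; split; nra.
Qed.

(** The mean value theorem is used twice on the segment: for [f], giving a parameter [c], then for
    its directional derivative [psi] on [0, c]. The remainder is [c] times a Hessian form with
    [c <= 1], so [L] is a bound on the Hessian without the factor 1/2. *)
Lemma descent_lemma rho : exists2 L : R, 0 < L &
  forall x y, box rho x -> box rho y ->
    f y <= f x + dot (grad f x) (y - x) + L * dot (y - x) (y - x).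
Proof.
have [df dg _] := fC2.
have [K K0 hK] := hess_bounded rho.
exists (K + 1); first by rewrite ltr_wpDl.
move=> x y bx bY; set v := y - x.
have D1 (t : R) : is_derive t 1 (fun s => f (x + s *: v)) (dot (grad f (x + t *: v)) v).
  by rewrite -derive_dot //; apply/is_derive_line/diff_derivable.
pose psi (s : R) := dot (grad f (x + s *: v)) v.
have D2 (t : R) : is_derive t 1 psi (dot (v *m 'J (grad f) (x + t *: v)) v).
  have dgv : derivable (grad f) (x + t *: v) v by exact: diff_derivable.
  have gi i : is_derive t 1 (fun s => grad f (x + s *: v) 0 i * v 0 i)
      ((v *m 'J (grad f) (x + t *: v)) 0 i * v 0 i).
    have -> : (v *m 'J (grad f) (x + t *: v)) 0 i =
        'D_v (fun z => grad f z 0 i) (x + t *: v).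
      by rewrite -deriveEjacobian // derive_mx // [LHS]mxE.
    have /derivable_mxP/(_ 0 i) dgi := dgv.
    have hi := is_derive_line _ _ _ _ _ dgi.
    have -> : (fun s => grad f (x + s *: v) 0 i * v 0 i) =
        (v 0 i) *: (fun s : R => grad f (x + s *: v) 0 i).
      by apply/funext => s; rewrite mulrC.
    rewrite mulrC.
    exact: (@is_deriveZ _ _ _ _ (v 0 i) t 1 _ hi).
  have := is_derive_sum gi.
  rewrite (_ : \sum_i _ = psi) //.
  by apply/funext => s; rewrite fct_sumE.
have [c /andP[c0 c1] fE] := MVT_derivable _ psi 0 1 ler01 (fun t _ => D1 t).
have [c' /andP[c'0 c'c] pE] := MVT_derivable psi _ 0 c c0 (fun t _ => D2 t).
have xvy : x + v = y by rewrite addrC subrK.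
move: fE; rewrite scale1r scale0r addr0 xvy subr0 mulr1.
move: pE; rewrite /psi scale0r addr0 subr0 => pE fE.
have bc : box rho (x + c' *: v) by apply: box_segment => //; rewrite c'0 (le_trans c'c).
have d0 := dot_ge0 v.
have : dot (v *m 'J (grad f) (x + c' *: v)) v * c <= K * dot v v * 1.
  apply: (@le_trans _ _ (K * dot v v * c)); first by rewrite ler_wpM2r // hK.
  by rewrite ler_wpM2l // mulr_ge0.
by rewrite -pE mulrDl; move: fE; rewrite /psi; lra.
Qed.

End SecondOrder.

(** * Soft-thresholding and residuals in one coordinate *)

Section Scalar.
Context {R : realType}.
Implicit Types x g w t v beta : R.

Definition soft1 t v : R := Num.sg v * Num.max (`|v| - t) 0.

Definition phi1 x g w : R :=
  if x == 0 then 0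
  else if (0 < x) && (0 < g + w) then Num.min (g + w) (Num.max x (g - w))
  else if (x < 0) && (g - w < 0) then Num.max (g - w) (Num.min x (g + w))
  else g + w * Num.sg x.

Definition psi1 x g w : R :=
  if x == 0 then
    if g + w < 0 then g + w else if 0 < g - w then g - w else 0
  else 0.

Variant soft1_spec t v : R -> Type :=
| Soft1Pos of t < v : soft1_spec t v (v - t)
| Soft1Neg of v < - t : soft1_spec t v (v + t)
| Soft1Zero of - t <= v <= t : soft1_spec t v 0.

Lemma soft1P t v : 0 < t -> soft1_spec t v (soft1 t v).
Proof.
move=> t0; rewrite /soft1.
have [tv|vt] := ltP t v.
  have v0 := lt_trans t0 tv.
  rewrite gtr0_sg // gtr0_norm // mul1r max_l ?subr_ge0 ?ltW //.
  exact: Soft1Pos.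
have [vNt|Ntv] := ltP v (- t).
  have v0 : v < 0 by rewrite (lt_trans vNt) // oppr_lt0.
  rewrite ltr0_sg // ltr0_norm // mulN1r max_l; last lra.
  by rewrite opprD !opprK; exact: Soft1Neg.
rewrite max_r ?mulr0 ?subr_le0 ?ler_norml ?Ntv //.
by apply: Soft1Zero; rewrite Ntv.
Qed.

Lemma soft1N t v : soft1 t (- v) = - soft1 t v.
Proof. by rewrite /soft1 sgrN normrN mulNr. Qed.

(** Reflection exchanges the two clipped cases; later arguments use it to assume [x] positive. *)
Lemma phi1N x g w : phi1 (- x) (- g) w = - phi1 x g w.
Proof.
rewrite /phi1 oppr_eq0; have [_|x0] := eqVneq x 0; first by rewrite oppr0.
have -> : - g + w = - (g - w) by ring.
have -> : - g - w = - (g + w) by ring.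
rewrite !oppr_gt0 !oppr_lt0 sgrN mulrN.
by case: (ltgtP x 0) x0 => //= _ _; case: ifP => _;
  rewrite ?oppr_min ?oppr_max ?oppr_min //; ring.
Qed.

(** This is the subgradient inequality at [x] for the proximal point [y]: the residual
    [x - beta * g - y] is a subgradient of [beta * w] times the absolute value at [y]. *)
Lemma soft1_descent x g w beta y : 0 < w -> 0 < beta ->
  y = soft1 (beta * w) (x - beta * g) ->
  beta * (g * (y - x) + w * (`|y| - `|x|)) <= - (y - x) ^+ 2.
Proof.
move=> w0 b0 ->; have t0 := mulr_gt0 b0 w0.
rewrite mulrDr !mulrA; move: (beta * g) (beta * w) t0 => bg t t0.
case: soft1P => // h.
- have := ler_norm x; rewrite (@ger0_norm _ (x - bg - t)); last lra.
  by nra.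
- have := ler_norm (- x); rewrite normrN (@ler0_norm _ (x - bg + t)); last lra.
  by nra.
- rewrite normr0 !sub0r.
  have /andP[h1 h2] := h; have [x0|x0] := lerP 0 x;
    [rewrite ger0_norm | rewrite ltr0_norm] => //; nra.
Qed.

(** Thresholding only shrinks its argument, so the bound is free of [w], which can blow up as eps
    tends to 0. *)
Lemma soft1_le x g w beta : 0 < w -> 0 < beta ->
  `|soft1 (beta * w) (x - beta * g)| <= `|x| + beta * `|g|.
Proof.
move=> w0 b0; have t0 := mulr_gt0 b0 w0.
rewrite -[beta in X in _ <= X](gtr0_norm b0) -normrM.
move: (beta * g) (beta * w) t0 => bg t t0.
apply: le_trans (ler_normB _ _).
by case: soft1P => // h; rewrite ?normr0 //;
  [rewrite !gtr0_norm | rewrite !ltr0_norm]; lra.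
Qed.

Lemma soft1_psi1 g w beta : 0 < w -> 0 < beta ->
  soft1 (beta * w) (0 - beta * g) = - (beta * psi1 0 g w).
Proof.
move=> w0 b0; have t0 := mulr_gt0 b0 w0.
rewrite /psi1 eqxx.
case: soft1P => // h.
- by rewrite ifT; [ring | nra].
- rewrite ifF; last by apply/negbTE; rewrite -leNgt; nra.
  by rewrite ifT; [ring | nra].
- rewrite ifF; last by apply/negbTE; rewrite -leNgt; nra.
  by rewrite ifF; [ring | apply/negbTE; rewrite -leNgt; nra].
Qed.

(** For positive [x] the step has length [beta * |g + w|] if it stays positive, [x] if it stops at
    0, and [beta * (g - w)] if it crosses. The min and max in [phi1] clip at these three quantities
    without [beta]; the factor [Num.min 1 beta] pays for the difference. *)
Lemma soft1_phi1 x g w beta : 0 < w -> 0 < beta -> x != 0 ->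
  Num.min 1 beta * `|phi1 x g w| <=
    `|soft1 (beta * w) (x - beta * g) - x|.
Proof.
move=> w0 b0.
wlog x0 : x g / 0 < x.
  move=> H x0; have [/H/(_ x0) //|xN] := ltP 0 x.
  have {}xN : 0 < - x by rewrite oppr_gt0 lt_neqAle x0.
  have := H (- x) (- g) xN (lt0r_neq0 xN).
  by rewrite phi1N normrN mulrN -opprD soft1N -opprD normrN.
move=> _; have t0 := mulr_gt0 b0 w0.
set c := Num.min 1 beta.
have c0 : 0 < c by rewrite lt_min ltr01.
have c1 : c <= 1 by rewrite ge_min lexx.
have cb : c <= beta by rewrite ge_min lexx orbT.
rewrite /phi1 gt_eqF // x0 (lt_gtF x0) /= gtr0_sg // mulr1.
have [gw|gw] := ltP 0 (g + w); last first.
  rewrite ler0_norm //; case: soft1P => // h; last 2 first.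
  - by exfalso; nra.
  - by exfalso; nra.
  by rewrite ger0_norm; nra.
set p := Num.min _ _.
have p0 : 0 < p by rewrite lt_min gw lt_max x0.
have pgw : p <= g + w by rewrite ge_min lexx.
have cp1 : c * p <= 1 * p by rewrite ler_wpM2r // ltW.
have cpb : c * p <= beta * p by rewrite ler_wpM2r // ltW.
have pmax : p <= Num.max x (g - w) by rewrite ge_min lexx orbT.
rewrite gtr0_norm //.
case: soft1P => // h.
- rewrite ler0_norm; last nra.
  by have := ler_wpM2l (ltW b0) pgw; lra.
- rewrite ler0_norm; last nra.
  move: pmax; rewrite le_max => /orP[px|pg]; first by nra.
  by have := ler_wpM2l (ltW b0) pg; lra.
- rewrite sub0r normrN gtr0_norm //.
  move: pmax; rewrite le_max => /orP[px|pg]; first by lra.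
  by have := ler_wpM2l (ltW b0) pg; lra.
Qed.

(** If the sign is kept, the threshold is a plain gradient step for the smooth branch of the
    model. *)
Lemma soft1_same_sign x g w beta : 0 < w -> 0 < beta -> x != 0 ->
  let y := soft1 (beta * w) (x - beta * g) in
  Num.sg y = Num.sg x -> y - x = - (beta * (g + w * Num.sg x)).
Proof.
move=> w0 b0 x0 /=; have t0 := mulr_gt0 b0 w0; case: soft1P => // h.
- rewrite (@gtr0_sg _ (_ - _)); last lra.
  by move=> <-; ring.
- rewrite (@ltr0_sg _ (_ + _)); last lra.
  by move=> <-; ring.
- by rewrite sgr0 => /esym/eqP; rewrite sgr_eq0 (negbTE x0).
Qed.

(** At [x = 0] the excess of |g| over [w] is exactly |psi1|; at [x > 0] any excess is at most
    |phi1|, whether [g] lies below [- w] or above [w]. No case split on [x] is left, so the bound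
    passes to cluster points with a vanishing coordinate. *)
Lemma multiplier_bound x g w : 0 < w ->
  `|g| <= w + `|psi1 x g w| + `|phi1 x g w|.
Proof.
move=> w0.
have [->|x0] := eqVneq x 0.
  rewrite /psi1 /phi1 eqxx normr0 addr0.
  case: ifP => [gw|/negbT]; first by rewrite !ltr0_norm; lra.
  rewrite -leNgt => gw; case: ifP => [gw'|/negbT]; first by rewrite !gtr0_norm; lra.
  by rewrite -leNgt normr0 ler_norml => gw'; lra.
rewrite {1}/psi1 (negbTE x0) normr0 addr0.
wlog xp : x g x0 / 0 < x.
  move=> H; have [/H-> //|xN] := ltP 0 x.
  have {}xN : 0 < - x by rewrite oppr_gt0 lt_neqAle x0.
  by have := H (- x) (- g) (lt0r_neq0 xN) xN; rewrite phi1N !normrN.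
rewrite /phi1 (negbTE x0) xp (lt_gtF xp) /= gtr0_sg // mulr1.
have [gw|gw] := ltP 0 (g + w); last by rewrite !ler0_norm; lra.
have [wg|gw'] := ltP w g; last by rewrite -[leLHS]addr0 lerD // ler_norml; lra.
have p : g - w <= Num.min (g + w) (Num.max x (g - w)).
  by rewrite le_min le_max lexx orbT andbT; lra.
rewrite (@gtr0_norm _ g) ?(le_trans _ (lerD (lexx w) (ler_norm _))) //; lra.
Qed.

(** For positive [x] the clipping value is at least [x], so a residual smaller than [x] cannot be
    clipped. *)
Lemma phi1_grad x g w : 0 < w -> x != 0 -> `|phi1 x g w| < `|x| ->
  `|g + w * Num.sg x| = `|phi1 x g w|.
Proof.
move=> w0.
wlog xp : x g / 0 < x.
  move=> H x0; have [xp|xN] := ltP 0 x; first exact: H.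
  have {}xN : 0 < - x by rewrite oppr_gt0 lt_neqAle x0.
  have := H (- x) (- g) xN (lt0r_neq0 xN).
  by rewrite phi1N !normrN sgrN mulrN -opprD normrN.
rewrite /phi1 => x0; rewrite (negbTE x0) xp (lt_gtF xp) /= gtr0_sg // mulr1.
have [gw|gw] // := ltP 0 (g + w).
have [//|px] := leP (g + w) (Num.max x (g - w)).
rewrite gtr0_norm ?lt_max ?xp // gtr0_norm // gt_max ltxx //.
Qed.

End Scalar.

(** * The smoothed objective and its weighted-l1 model *)

Section ObjectiveTheory.
Context {R : realType} {n : nat} {lam : R} {f : 'rV[R]_n -> R} {r : R -> R}.
Context (lam_gt0 : 0 < lam) (rP : regularizer r).
Implicit Types (x y e d : 'rV[R]_n).

Local Notation Fe := (Feps lam f r).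
Local Notation G := (Gmodel lam f r).

Lemma weight_gt0 x e i : 0 < e 0 i -> 0 < weight lam r x e 0 i.
Proof.
move=> e0; rewrite mxE mulr_gt0 //; case: rP => _ _ _ r1 _.
by apply: r1; rewrite ltr_wpDl.
Qed.

Lemma PsiE x e i :
  Psi lam f r x e 0 i = psi1 (x 0 i) (partial f i x) (weight lam r x e 0 i).
Proof. by rewrite [LHS]mxE. Qed.

Lemma PhiE x e i :
  Phi lam f r x e 0 i = phi1 (x 0 i) (partial f i x) (weight lam r x e 0 i).
Proof. by rewrite [LHS]mxE. Qed.

(** The tangent inequality for [r] at |x_i| + e_i in each coordinate; the shifts e_i cancel and the
    slopes are the weights. *)
Lemma Feps_majorize x y e : (forall i, 0 < e 0 i) ->
  Fe e y - Fe e x <= G x e y - G x e x.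
Proof.
move=> e0; rewrite /Feps /Gmodel !opprD [leLHS]addrACA [leRHS]addrACA lerD2l -mulrBr -!sumrB.
rewrite mulr_sumr; apply: ler_sum => i _.
rewrite -mulrBr mxE -mulrA ler_pM2l //.
have := regularizer_tangent rP (`|x 0 i| + e 0 i) (`|y 0 i| + e 0 i).
rewrite opprD addrACA subrr addr0; apply; exact: ltr_wpDl.
Qed.

(** [e1] may vanish, so this covers both the update of eps and the comparison with the unsmoothed
    [F]. *)
Lemma Feps_le x e1 e2 : (forall i, 0 <= e1 0 i <= e2 0 i) -> Fe e1 x <= Fe e2 x.
Proof.
move=> e12; rewrite lerD2l ler_pM2l //; apply: ler_sum => i _.
have /andP[e1_ge0 e1e2] := e12 i.
by apply: (regularizer_le0 rP); rewrite ?addr_ge0 ?lerD2l.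
Qed.

Lemma F_le_Feps x e : (forall i, 0 < e 0 i) -> F lam f r x <= Fe e x.
Proof. by move=> e0; apply: Feps_le => i; rewrite mxE lexx ltW. Qed.

(** Near a nonzero [u] the absolute value is multiplication by the constant [Num.sg u], so the chain
    rule applies. *)
Lemma is_derive_regularizer_norm (u c : R) : u != 0 -> 0 < c ->
  is_derive u 1 (fun t => r (`|t| + c)) (derive1 r (`|u| + c) * Num.sg u).
Proof.
move=> u0 c0.
have D : is_derive u 1 (r \o (fun t => Num.sg u *: t + c))
    (derive1 r (`|u| + c) * Num.sg u).
  apply: is_derive1_comp.
    have -> : Num.sg u *: u = `|u| by rewrite [RHS]normrEsg.
    by apply: (regularizer_is_derive rP); rewrite ltr_wpDl.
  have := @is_deriveD _ _ _ _ _ u 1 _ _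
    (@is_deriveZ _ _ _ _ (Num.sg u) u 1 _ (is_derive_id u 1)) (is_derive_cst c u 1).
  by rewrite addr0 [_ *: _]mulr1.
apply: near_eq_is_derive D.
have [up|un] := ltP 0 u.
  near=> t; rewrite /= gtr0_sg // scale1r gtr0_norm //.
  by near: t; exact: lt_nbhsr.
have {}un : u < 0 by rewrite lt_neqAle u0.
near=> t; rewrite /= ltr0_sg // scaleN1r ltr0_norm //.
by near: t; exact: lt_nbhsl.
Unshelve. all: by end_near. Qed.

Lemma partial_Feps x e i : differentiable f x -> x 0 i != 0 -> 0 < e 0 i ->
  partial (Fe e) i x = partial f i x + weight lam r x e 0 i * Num.sg (x 0 i).
Proof.
move=> df xi0 ei0; set v : 'rV[R]_n := delta_mx 0 i.
have fD : is_derive x v f (partial f i x) by apply: DeriveDef => //; exact: diff_derivable.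
pose q (z : 'rV[R]_n) := r (`|z 0 i| + e 0 i).
have qD : is_derive x v q (derive1 r (`|x 0 i| + e 0 i) * Num.sg (x 0 i)).
  have [] := is_derive_regularizer_norm (x 0 i) (e 0 i) xi0 ei0.
  rewrite /derivable /derive => dq Dq.
  have E : (fun s : R => s^-1 *: (q (s *: v + x) - q x)) =
      (fun s : R => s^-1 *: (r (`|s *: 1 + x 0 i| + e 0 i) - r (`|x 0 i| + e 0 i))).
    by apply/funext => s; rewrite /q !mxE !eqxx.
  by apply: DeriveDef; rewrite /derivable /derive /= E.
have [_ FD] := is_deriveD fD (@is_deriveZ _ _ _ _ lam x v _ qD).
transitivity ('D_v (f + lam *: q) x); last by rewrite FD mxE -mulrA.
rewrite /partial -/v /derive.
suff -> : (fun s : R => s^-1 *: (Fe e (s *: v + x) - Fe e x)) =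
    (fun s : R => s^-1 *: ((f + lam *: q) (s *: v + x) - (f + lam *: q) x)) by [].
apply/funext => s; congr (_ *: _).
transitivity (f (s *: v + x) - f x + lam * (q (s *: v + x) - q x)); last first.
  by rewrite mulrBr addrACA -opprD.
rewrite /Feps opprD addrACA -mulrBr -sumrB; congr (_ + lam * _).
rewrite (bigD1 i) //= big1 ?addr0 // => j /negbTE ji.
by rewrite !mxE ji mulr0n mulr0 add0r subrr.
Qed.

End ObjectiveTheory.

(** * The IST step: its stepsize and its control of the residuals *)

Section Thresholding.
Context {R : realType} {n : nat} {lam : R} {f : 'rV[R]_n -> R} {r : R -> R}.
Context {P : irena_params R}.
Context (lam_gt0 : 0 < lam) (fC2 : C2 f) (rP : regularizer r).
Context (PP : admissible P).
Implicit Types (x y e d : 'rV[R]_n) (W : {set 'I_n}) (rad : R) (j : nat).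

Local Notation beta j := (beta_bar P * gam_beta P ^+ j).

Lemma beta_gt0 j : 0 < beta j.
Proof.
by case: PP => _ [_ /andP[gb _] _] _ [bb _] _; rewrite mulr_gt0 // exprn_gt0.
Qed.

Lemma beta_homo i j : (i <= j)%N -> beta j <= beta i.
Proof.
case: PP => _ [_ /andP[gb gb1] _] _ [bb _] _ ij.
by rewrite ler_pM2l // ler_wiXn2l // ltW.
Qed.

Lemma beta_small (K : R) : exists j, beta j * K <= 1.
Proof.
case: PP => _ [_ /andP[gb gb1] _] _ [bb _] _.
have [K0|K0] := leP K 0.
  by exists 0%N; rewrite (le_trans _ ler01) // mulr_ge0_le0 // ltW // beta_gt0.
have /cvgrPdist_lt/(_ (beta_bar P * K)^-1) : gam_beta P ^+ j @[j --> \oo] --> (0 : R).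
  by apply: cvg_expr; rewrite ger0_norm // ltW.
rewrite invr_gt0 mulr_gt0 // => /(_ isT) [j _ /(_ j (leqnn j))] /=.
rewrite sub0r normrN gtr0_norm ?exprn_gt0 // => hj; exists j.
rewrite mulrAC mulrC -ler_pdivlMr ?mulr_gt0 // div1r; exact: ltW.
Qed.

Lemma ist_trialE x e W j i : ist_trial lam f r P x e W j 0 i =
  if i \in W then soft1 (beta j * weight lam r x e 0 i) (x 0 i - beta j * partial f i x)
  else x 0 i.
Proof. by rewrite mxE; case: ifP => // _; rewrite /soft !mxE. Qed.

Lemma ist_trial_box x e W j rad (K : R) : (forall i, 0 < e 0 i) -> 0 <= K ->
  box rad x -> (forall i, `|partial f i x| <= K) ->
  box (rad + beta_bar P * K) (ist_trial lam f r P x e W j).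
Proof.
move=> e0 K0 bx gK i; rewrite ist_trialE.
have b0 := beta_gt0 j; have w0 := weight_gt0 lam_gt0 rP x e i (e0 i).
have b1 : beta j <= beta_bar P by have := beta_homo 0 j (leq0n j); rewrite mulr1.
have bb0 := lt_le_trans b0 b1.
case: ifP => _; last by rewrite (le_trans (bx i)) // lerDl mulr_ge0 // ltW.
apply: le_trans (soft1_le _ _ _ _ w0 b0) _.
by rewrite lerD // ler_pM // ltW.
Qed.

(** Summing [soft1_descent] over the coordinates, the linearized model drops by at least |y - x|^2 /
    beta; for small beta this pays for the curvature [L] of [f] and for the required decrease. *)
Lemma ist_accept_small x e W j (L : R) : (forall i, 0 < e 0 i) ->
  let y := ist_trial lam f r P x e W j in
  f y <= f x + dot (grad f x) (y - x) + L * dot (y - x) (y - x) ->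
  beta j * (L + xi_beta P / 2) <= 1 ->
  ist_accept lam f r P x e W j.
Proof.
move=> e0 y fL bL; have b0 := beta_gt0 j.
rewrite /ist_accept -/y /Gmodel norm2_sqr.
have S : beta j * \sum_(i < n) (partial f i x * (y 0 i - x 0 i) +
    weight lam r x e 0 i * (`|y 0 i| - `|x 0 i|)) <= - dot (y - x) (y - x).
  rewrite mulr_sumr -sumrN; apply: ler_sum => i _.
  rewrite [(y - x) 0 i]mxE [(- x) 0 i]mxE -expr2.
  have w0 := weight_gt0 lam_gt0 rP x e i (e0 i).
  have := ist_trialE x e W j i; rewrite -/y; case: ifP => _ yE.
    exact: soft1_descent.
  by rewrite yE !subrr !mulr0 addr0 mulr0 expr0n oppr0.
have E : \sum_(i < n) (partial f i x * (y 0 i - x 0 i) +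
      weight lam r x e 0 i * (`|y 0 i| - `|x 0 i|)) =
    dot (grad f x) (y - x) + (\sum_(i < n) weight lam r x e 0 i * `|y 0 i| -
      \sum_(i < n) weight lam r x e 0 i * `|x 0 i|).
  rewrite big_split /= -sumrB; congr (_ + _); apply: eq_bigr => i _.
    by rewrite !mxE.
  by rewrite mulrBr.
have d0 := dot_ge0 (y - x).
have : beta j * (dot (grad f x) (y - x) + (\sum_(i < n) weight lam r x e 0 i * `|y 0 i| -
      \sum_(i < n) weight lam r x e 0 i * `|x 0 i|)) <=
    beta j * (- (L + xi_beta P / 2) * dot (y - x) (y - x)).
  rewrite -E (le_trans S) // mulrA mulrN mulNr lerN2.
  by rewrite -[leRHS]mul1r ler_wpM2r.
rewrite ler_pM2l // => {}S; move: S; rewrite mulNr mulrDl; lra.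
Qed.

Lemma dot_subvec_le W (u v : 'rV[R]_n) (c : R) : 0 <= c ->
  (forall i, i \in W -> c * `|u 0 i| <= `|v 0 i|) ->
  c ^+ 2 * dot (subvec W u) (subvec W u) <= dot v v.
Proof.
move=> c0 uv; rewrite mulr_sumr; apply: ler_sum => i _; rewrite !mxE.
case: ifP => [iW|_]; last by rewrite !mulr0 -expr2 sqr_ge0.
rewrite -!expr2 -exprMn -(real_normK (num_real (v 0 i))) -(real_normK (num_real (c * _))).
by rewrite normrM ger0_norm // lerXn2r ?nnegrE ?mulr_ge0 // uv.
Qed.

(** A nonzero entry of Psi forces x_i = 0 and a nonzero entry of Phi forces x_i != 0, so on [W] one
    scalar estimate applies throughout. The selection rule then passes from [W] to the whole
    residual. *)
Lemma ist_displacement x e W j (c : R) : (forall i, 0 < e 0 i) ->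
  working_set lam f r P x e W -> 0 <= c -> c <= 1 -> c <= beta j ->
  let y := ist_trial lam f r P x e W j in
  (eta P * norm2 (Phi lam f r x e) <= norm2 (Psi lam f r x e) /\
   c ^+ 2 * (eta_Psi P * norm2 (Psi lam f r x e)) ^+ 2 <= dot (y - x) (y - x)) \/
  (norm2 (Psi lam f r x e) <= eta P * norm2 (Phi lam f r x e) /\
   c ^+ 2 * (eta_Phi P * norm2 (Phi lam f r x e)) ^+ 2 <= dot (y - x) (y - x)).
Proof.
move=> e0 WP c0 c1 cb y; have b0 := beta_gt0 j.
have [[/andP[eP0 _] /andP[eS0 _]] _ _ _ _] := PP.
have sq (a : R) (u : 'rV[R]_n) : 0 <= a -> a <= norm2 (subvec W u) ->
    (forall i, i \in W -> c * `|u 0 i| <= `|(y - x) 0 i|) ->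
    c ^+ 2 * a ^+ 2 <= dot (y - x) (y - x).
  move=> a0 au /(dot_subvec_le _ _ _ _ c0); apply: le_trans.
  rewrite ler_wpM2l ?sqr_ge0 // -norm2_sqr lerXn2r ?nnegrE ?norm2_ge0 //.
move: WP; rewrite /working_set; case: (leP (eta P * _)) => h [nz nW].
  left; split=> //; apply: sq nW _; first by rewrite mulr_ge0 ?norm2_ge0 // ltW.
  move=> i iW; have := nz i iW; rewrite PsiE [(y - x) 0 i]mxE [(- x) 0 i]mxE ist_trialE iW.
  have w0 := weight_gt0 lam_gt0 rP x e i (e0 i).
  rewrite {1}/psi1; case: (eqVneq (x 0 i) 0) => [xi _|_ /eqP //].
  rewrite xi soft1_psi1 // subr0 normrN normrM (gtr0_norm b0).
  by rewrite ler_wpM2r.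
right; split; first exact: ltW.
apply: sq nW _; first by rewrite mulr_ge0 ?norm2_ge0 // ltW.
move=> i iW; have := nz i iW; rewrite PhiE [(y - x) 0 i]mxE [(- x) 0 i]mxE ist_trialE iW.
have w0 := weight_gt0 lam_gt0 rP x e i (e0 i).
rewrite {1}/phi1; case: (eqVneq (x 0 i) 0) => [_ /eqP //|xi _].
apply: le_trans (soft1_phi1 _ _ _ _ w0 b0 xi).
by rewrite ler_wpM2r // le_min c1.
Qed.

(** All constants depend only on the box. Trial [j0] would be accepted, so backtracking stops no
    later and the stepsize is at least [beta j0]. The test defining the working set bounds the
    residual that was not selected by the one that was. *)
Lemma ist_controls_residual rad : exists bmin C rho : R,
  [/\ 0 < bmin, 0 <= C &
  forall x e W xhat, box rad x -> (forall i, 0 < e 0 i) ->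
    working_set lam f r P x e W -> ist_step lam f r P x e W xhat ->
    exists j, [/\ xhat = ist_trial lam f r P x e W j,
      ist_accept lam f r P x e W j, bmin <= beta j,
      box rho xhat &
      dot (Phi lam f r x e) (Phi lam f r x e) +
      dot (Psi lam f r x e) (Psi lam f r x e) <= C * dot (xhat - x) (xhat - x)]].
Proof.
have [[/andP[eP0 _] /andP[eS0 _]] _ [eta0 xib0 _] [bb0 _] _] := PP.
have [K K0 KP] := grad_bounded fC2 rad.
set rho := rad + beta_bar P * K.
have radrho : rad <= rho by rewrite lerDl mulr_ge0 // ltW.
have [L L0 LP] := descent_lemma fC2 rho.
have [j0 j0P] := beta_small (L + xi_beta P / 2).
have b0 := beta_gt0 j0.
set c := Num.min 1 (beta j0).
have c0 : 0 < c by rewrite lt_min ltr01.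
pose k1 := c ^+ 2 * eta_Psi P ^+ 2; pose k2 := c ^+ 2 * eta_Phi P ^+ 2.
have k10 : 0 < k1 by rewrite mulr_gt0 // exprn_gt0.
have k20 : 0 < k2 by rewrite mulr_gt0 // exprn_gt0.
(* One summand for each residual that may have been selected: Psi first, then Phi. *)
exists (beta j0), (k1^-1 * (1 + (eta P ^+ 2)^-1) + k2^-1 * (1 + eta P ^+ 2)), rho.
have e20 : 0 < eta P ^+ 2 by rewrite exprn_gt0.
have A0 : 0 <= k1^-1 * (1 + (eta P ^+ 2)^-1).
  by rewrite mulr_ge0 ?addr_ge0 ?invr_ge0 ?ltW.
have B0 : 0 <= k2^-1 * (1 + eta P ^+ 2) by rewrite mulr_ge0 ?addr_ge0 ?invr_ge0 ?ltW.
split=> //; first exact: addr_ge0.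
move=> x e W xhat bx e0 WP [j [jacc jmin ->]]; exists j.
have bt i : box rho (ist_trial lam f r P x e W i).
  by apply: ist_trial_box => // k; exact: KP.
have jj0 : (j <= j0)%N.
  rewrite leqNgt; apply/negP => /jmin; apply; apply: (ist_accept_small x e W j0 L e0 _ j0P).
    apply: LP; last exact: bt.
    by move=> i; rewrite (le_trans (bx i)).
have bj := beta_homo _ _ jj0.
have c1 : c <= 1 by rewrite ge_min lexx.
have cb : c <= beta j by rewrite ge_min bj orbT.
split=> //.
set y := ist_trial _ _ _ _ _ _ _ _.
rewrite -!norm2_sqr; set p := norm2 (Phi _ _ _ _ _); set s := norm2 (Psi _ _ _ _ _).
have p0 : 0 <= p := norm2_ge0 _.
have s0 : 0 <= s := norm2_ge0 _.
rewrite mulrDl.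
have d0 := sqr_ge0 (norm2 (y - x)).
have := ist_displacement x e W j c e0 WP (ltW c0) c1 cb.
rewrite /= -/y -/p -/s -norm2_sqr !exprMn => -[[ps]|[sp]].
- rewrite mulrA -/k1 => h; rewrite (ler_wpDr (mulr_ge0 B0 d0)) //.
  have : s ^+ 2 <= k1^-1 * norm2 (y - x) ^+ 2 by rewrite ler_pdivlMl.
  have : p ^+ 2 <= (eta P ^+ 2)^-1 * s ^+ 2.
    rewrite ler_pdivlMl // -exprMn lerXn2r ?nnegrE //.
    by rewrite mulr_ge0 // ltW.
  have i0 : 0 < (eta P ^+ 2)^-1 by rewrite invr_gt0.
  move: ((eta P ^+ 2)^-1) (k1^-1) i0 => a b i0 ph sh.
  by have := ler_wpM2l (ltW i0) sh; lra.
- rewrite mulrA -/k2 => h; rewrite (ler_wpDl (mulr_ge0 A0 d0)) //.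
  have : p ^+ 2 <= k2^-1 * norm2 (y - x) ^+ 2 by rewrite ler_pdivlMl.
  have : s ^+ 2 <= eta P ^+ 2 * p ^+ 2.
    by rewrite -exprMn lerXn2r ?nnegrE // mulr_ge0 // ltW.
  move: (k2^-1) => b sh ph; have := ler_wpM2l (ltW e20) ph; lra.
Qed.

End Thresholding.

(** * Orthants, the breakpoint [alpha_B] and the states of the line search *)

Section LineSearch.
Context {R : realType} {n : nat}.
Context {P : irena_params R}.
Context (PP : admissible P).
Implicit Types (x y e d : 'rV[R]_n) (a b t : R) (j : nat).

Definition open_orthant x y := forall i, x 0 i != 0 -> 0 < Num.sg (x 0 i) * y 0 i.

Definition closed_orthant x y := forall i, 0 <= Num.sg (x 0 i) * y 0 i.

Lemma orthant_proj_open x y : sgnv (orthant_proj y x) = sgnv x -> open_orthant x y.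
Proof.
move=> s i xi0; have /rowP/(_ i) := s; rewrite !mxE.
have [//|h] := ltP 0 (Num.sg (x 0 i) * y 0 i).
by rewrite mulr0 sgr0 => /esym/eqP; rewrite sgr_eq0 (negbTE xi0).
Qed.

Lemma orthant_proj_id x y : closed_orthant x y ->
  (forall i, x 0 i = 0 -> y 0 i = 0) -> orthant_proj y x = y.
Proof.
move=> c s; apply/rowP => i; rewrite mxE max_r //.
have [xi|xi] := eqVneq (x 0 i) 0; first by rewrite xi sgr0 mul0r s.
by rewrite mulrA -expr2 sqr_sg xi mul1r.
Qed.

Lemma open_orthant_sgnv x y : open_orthant x y ->
  (forall i, x 0 i = 0 -> y 0 i = 0) -> sgnv y = sgnv x.
Proof.
move=> o s; apply/rowP => i; rewrite !mxE.
have [xi|xi] := eqVneq (x 0 i) 0; first by rewrite xi s.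
have /gtr0_sg := o i xi; rewrite sgrM sgr_id.
by case: sgrP => //; case: sgrP => //;
  rewrite ?(mul0r, mulr0, mul1r, mulN1r, mulrN1, opprK) => *; lra.
Qed.

Lemma sgnv_open_orthant x y : sgnv y = sgnv x -> open_orthant x y.
Proof.
move=> s i xi; have /rowP/(_ i) := s; rewrite !mxE => <-.
rewrite -normrEsg normr_gt0 -sgr_eq0.
by have /rowP/(_ i) := s; rewrite !mxE => ->; rewrite sgr_eq0.
Qed.

Lemma alpha_B_ub x d a : 0 < a -> sgnv (x + a *: d) = sgnv x ->
  (a%:E <= alpha_B x d)%E.
Proof. by move=> a0 s; apply: ereal_sup_ubound; exists a. Qed.

Lemma orthant_lineE x d a i : Num.sg (x 0 i) * (x + a *: d) 0 i =
  `|x 0 i| + a * (Num.sg (x 0 i) * d 0 i).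
Proof. by rewrite !mxE mulrDr -normrEsg mulrCA. Qed.

Lemma closed_orthant_le x d a b : closed_orthant x (x + b *: d) ->
  0 <= a <= b -> closed_orthant x (x + a *: d).
Proof.
move=> c /andP[a0 ab] i; have := c i; rewrite !orthant_lineE.
by have := normr_ge0 (x 0 i); move: (_ * d 0 i) `|x 0 i| => u v; have [u0|u0] := leP 0 u; nra.
Qed.

(** A coordinate moving towards 0 reaches it at |x_i| / (- u), and no sign-preserving step exceeds
    that ratio; hence neither does the supremum. *)
Lemma closed_orthant_alpha_B x d a : 0 <= a -> (a%:E <= alpha_B x d)%E ->
  closed_orthant x (x + a *: d).
Proof.
move=> a0 aB i; rewrite orthant_lineE.
set u := Num.sg (x 0 i) * d 0 i.
have [u0|u0] := leP 0 u; first by rewrite addr_ge0 // mulr_ge0.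
have xi0 : x 0 i != 0.
  by apply: contraTneq u0 => xi; rewrite /u xi sgr0 mul0r ltxx.
have Nu : 0 < - u by rewrite oppr_gt0.
suff : a <= `|x 0 i| / - u by rewrite ler_pdivlMr //; lra.
rewrite -lee_fin (le_trans aB) //; apply: ge_ereal_sup => _ [t /= [t0 st] <-].
rewrite lee_fin ler_pdivlMr //.
have := sgnv_open_orthant _ _ st i xi0.
rewrite orthant_lineE -/u; lra.
Qed.

(** Finitely many strict inequalities, continuous in the step, persist slightly to the right of
    [a]. *)
Lemma open_orthant_extend x d a : open_orthant x (x + a *: d) ->
  exists2 b, a < b & open_orthant x (x + b *: d).
Proof.
move=> o.
have : \forall t \near a^'+, forall i, x 0 i != 0 ->
    0 < Num.sg (x 0 i) * (x 0 i + t * d 0 i).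
  apply: filter_forall => i.
  have [->|xi] := eqVneq (x 0 i) 0; first by apply: nearW.
  have c : Num.sg (x 0 i) * (x 0 i + t * d 0 i) @[t --> a^'+] -->
      Num.sg (x 0 i) * (x 0 i + a * d 0 i).
    apply: cvg_at_right_filter.
    apply: cvgM; first exact: cvg_cst.
    apply: cvgD; first exact: cvg_cst.
    by apply: cvgM; [exact: cvg_id|exact: cvg_cst].
  have h := o i xi; rewrite !mxE in h.
  near=> t => _; near: t; exact: (cvgr_gt _ c _ h).
move=> H; have [b [ab hb]] : exists b, a < b /\ forall i, x 0 i != 0 ->
    0 < Num.sg (x 0 i) * (x 0 i + b * d 0 i).
  by apply: (@filter_ex _ (a^'+)); apply: filterI => //; exact: nbhs_right_gt.
by exists b => // i xi; rewrite !mxE hb.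
Unshelve. all: by end_near. Qed.

(* A step truncated at [alpha_B] makes a coordinate vanish. *)
Lemma reset_full_step x d a : (forall i, x 0 i = 0 -> d 0 i = 0) -> 0 < a ->
  a%:E = Order.min 1%:E (alpha_B x d) -> open_orthant x (x + a *: d) -> a = 1.
Proof.
move=> sd a0 aE o.
have [aB|Ba] := leP 1%:E (alpha_B x d).
  by move: aE; rewrite min_l // => -[].
exfalso; have [b ab ob] := open_orthant_extend _ _ _ o.
have : (b%:E <= alpha_B x d)%E.
  apply: alpha_B_ub; first exact: lt_trans ab.
  by apply: open_orthant_sgnv ob _ => i xi; rewrite !mxE xi sd // mulr0 addr0.
move: aE; rewrite min_r ?(ltW Ba) // => <-.
by rewrite lee_fin leNgt ab.
Qed.

(** [alpha_B] may be infinite, but the minimum lies between [a] and 1, so [fine] reads its true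
    value; the reset never shortens the step. *)
Lemma reset_fin x d a : 0 < a <= 1 -> sgnv (x + a *: d) = sgnv x ->
  exists2 b, a <= b <= 1 & b%:E = Order.min 1%:E (alpha_B x d).
Proof.
move=> /andP[a0 a1] s; have aB := alpha_B_ub _ _ _ a0 s.
have fin : Order.min 1%:E (alpha_B x d) \is a fin_num.
  rewrite fin_numE; apply/andP; split.
    by rewrite gt_eqF // lt_min ltNyr (lt_le_trans (ltNyr a)).
  by rewrite lt_eqF // gt_min ltry.
exists (fine (Order.min 1%:E (alpha_B x d))); last by rewrite fineK.
by rewrite -!lee_fin fineK // le_min lee_fin a1 aB ge_min lexx.
Qed.

Lemma ls_point_open_sgnv x d a : (forall i, x 0 i = 0 -> d 0 i = 0) ->
  sgnv (ls_point x d a) = sgnv x -> sgnv (x + a *: d) = sgnv x.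
Proof.
move=> sd /orthant_proj_open o; apply: open_orthant_sgnv o _ => i xi.
by rewrite !mxE xi sd // mulr0 addr0.
Qed.

(** The last clause drives the stepsize bound: a sign-preserving trial comes after the reset, and
    either it has step 1 or the preceding trial was also past the reset, with a step longer by the
    factor [1 / gam_alpha P]. A reset truncated below 1 is excluded, as it makes a coordinate
    vanish. *)
Lemma ls_state_inv x d j : (forall i, x 0 i = 0 -> d 0 i = 0) ->
  [/\ 0 < (ls_state P x d j).1 <= 1,
      (ls_state P x d j).2 ->
        closed_orthant x (x + (ls_state P x d j).1 *: d),
      ~~ (ls_state P x d j).2 -> sgnv (ls_trial P x d j) != sgnv x
    & sgnv (ls_trial P x d j) = sgnv x ->
        (ls_state P x d j).1 = 1 \/
        exists j', [/\ j = j'.+1, (ls_state P x d j').2 &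
          (ls_state P x d j).1 = gam_alpha P * (ls_state P x d j').1]].
Proof.
move=> sd; have [_ [_ _ /andP[g0 g1]] _ _ _] := PP.
have reset a : 0 < a <= 1 -> sgnv (ls_point x d a) = sgnv x ->
    [/\ 0 < fine (Order.min 1%:E (alpha_B x d)) <= 1,
        closed_orthant x (x + fine (Order.min 1%:E (alpha_B x d)) *: d) &
        sgnv (ls_point x d (fine (Order.min 1%:E (alpha_B x d)))) = sgnv x ->
        fine (Order.min 1%:E (alpha_B x d)) = 1].
  move=> a01 s; have [a0 _] := andP a01.
  have [b /andP[ab b1] bE] := reset_fin _ _ _ a01 (ls_point_open_sgnv _ _ _ sd s).
  have b0 := lt_le_trans a0 ab.
  rewrite -bE /=; split; first by rewrite b0.
    by apply: closed_orthant_alpha_B; [exact: ltW|rewrite bE ge_min lexx orbT].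
  by move=> /orthant_proj_open; exact: reset_full_step.
rewrite /ls_trial; elim: j => [|j [/andP[a0 a1] cl ns _]] /=.
  case: eqVneq => [s|s] /=; last by split => //; [rewrite ltr01 lexx|move=> h; rewrite h eqxx in s].
  have [h1 h2 h3] := reset 1 (eq_trans (congr1 (andb^~ _) ltr01) (lexx 1)) s.
  by split => // /h3 ?; left.
have [a [b E]] : exists a (b : bool), ls_state P x d j = (a, b).
  by case: (ls_state P x d j) => a b'; exists a, b'.
rewrite E /= in a0 a1 cl ns *.
have ga0 : 0 < gam_alpha P * a by rewrite mulr_gt0.
have ga1 : gam_alpha P * a <= 1 by rewrite mulr_ile1 // ltW.
have gaa : gam_alpha P * a <= a by rewrite ler_piMl // ltW.
(* If the reset is in the past, the step only shrinks inside the closed orthant; otherwise the sign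
   test decides whether the reset happens now. *)
case: b E cl ns => /= E cl ns.
  split=> //; first by rewrite ga0.
    by move=> _; apply: closed_orthant_le (cl isT) _; rewrite gaa ltW.
  by move=> _; right; exists j; rewrite E.
case: eqVneq => [s|s] /=; last first.
  by split => //; [rewrite ga0|move=> h; rewrite h eqxx in s].
have [|h1 h2 h3] := reset _ _ s; first by rewrite ga0.
by split => // /h3 ?; left.
Qed.

End LineSearch.

(** * The QP step: descent, stepsize and comparison with the IST step *)

Section QuadraticStep.
Context {R : realType} {n : nat} {lam : R} {f : 'rV[R]_n -> R} {r : R -> R}.
Context {P : irena_params R}.
Context (lam_gt0 : 0 < lam) (fC2 : C2 f) (rP : regularizer r).
Context (PP : admissible P).
Implicit Types (x y e d xt xhat : 'rV[R]_n) (W : {set 'I_n}) (rad a z : R) (j : nat).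

Local Notation beta j := (beta_bar P * gam_beta P ^+ j).
Local Notation Fe := (Feps lam f r).

(** If the accepted step is not 1, the preceding trial was rejected although it lay in the closed
    orthant, so its step exceeded [astar]. *)
Lemma line_search_step x e d xt (astar : R) : (forall i, x 0 i = 0 -> d 0 i = 0) ->
  (forall a, 0 < a <= 1 -> a <= astar -> closed_orthant x (x + a *: d) ->
    Fe e (x + a *: d) <= Fe e x - xi_alpha P / 2 * norm2 (a *: d) ^+ 2) ->
  line_search lam f r P x e d xt -> sgnv xt = sgnv x ->
  exists2 a, Num.min 1 (gam_alpha P * astar) <= a <= 1 & xt = x + a *: d.
Proof.
move=> sd small [j [_ jmin ->]] s.
have [_ [_ _ /andP[g0 g1]] _ _ _] := PP.
have trialE k : (ls_state P x d k).2 ->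
    ls_trial P x d k = x + (ls_state P x d k).1 *: d.
  move=> b; have [_ /(_ b) cl _ _] := ls_state_inv PP x d k sd.
  by apply: orthant_proj_id => // i xi; rewrite !mxE xi sd // mulr0 addr0.
have [/andP[a0 a1] _ ns full] := ls_state_inv PP x d j sd.
have b : (ls_state P x d j).2.
  by apply: contra_eqT s => /ns.
exists (ls_state P x d j).1; last exact: trialE.
rewrite a1 andbT ge_min; have [->|[j' [jE b' ->]]] := full s; first by rewrite lexx.
apply/orP; right; rewrite ler_pM2l //.
have [a'01 /(_ b') cl _ _] := ls_state_inv PP x d j' sd.
rewrite leNgt; apply/negP => /ltW ha; apply: (jmin j'); first by rewrite jE.
by rewrite /ls_accept trialE // [X in norm2 X]addrC addKr small.
Qed.

(** A zero coordinate selected through Psi moves by [- beta] times a nonzero residual, which would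
    change its sign. *)
Lemma same_sign_working_set x e W j : (forall i, 0 < e 0 i) ->
  working_set lam f r P x e W ->
  sgnv (ist_trial lam f r P x e W j) = sgnv x ->
  forall i, i \in W -> x 0 i != 0.
Proof.
move=> e0 WP s i iW; have b0 := beta_gt0 PP j.
have w0 := weight_gt0 lam_gt0 rP x e i (e0 i).
move: WP; rewrite /working_set; case: ifP => _ [nz _]; have := nz i iW; last first.
  by apply: contra_neq => xi; rewrite PhiE /phi1 xi eqxx.
rewrite PsiE; apply: contra_neq => xi; rewrite xi.
have /rowP/(_ i) := s; rewrite [LHS]mxE [RHS]mxE ist_trialE iW xi soft1_psi1 //.
by rewrite sgr0 => /eqP; rewrite sgr_eq0 oppr_eq0 mulf_eq0 gt_eqF // => /eqP.
Qed.

Lemma qp_gradE x e W i : (forall i, 0 < e 0 i) ->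
  (forall i, i \in W -> x 0 i != 0) ->
  qp_grad lam f r x e W 0 i =
  if i \in W then partial f i x + weight lam r x e 0 i * Num.sg (x 0 i) else 0.
Proof.
move=> e0 Wx; rewrite mxE; case: ifP => // iW; rewrite mxE.
by rewrite (partial_Feps rP) //; [case: fC2 | exact: Wx].
Qed.

Lemma ist_step_gradient x e W j : (forall i, 0 < e 0 i) ->
  working_set lam f r P x e W ->
  sgnv (ist_trial lam f r P x e W j) = sgnv x ->
  ist_trial lam f r P x e W j - x = - beta j *: qp_grad lam f r x e W.
Proof.
move=> e0 WP s; have Wx := same_sign_working_set _ _ _ _ e0 WP s.
apply/rowP => i; rewrite [LHS]mxE [(- x) 0 i]mxE [RHS]mxE qp_gradE //.
have /rowP/(_ i) := s; rewrite [LHS]mxE [RHS]mxE ist_trialE.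
case: ifP => [iW si|_ _]; last by rewrite mulr0 subrr.
rewrite mulNr; apply: soft1_same_sign => //; last exact: Wx.
  exact: (weight_gt0 lam_gt0 rP).
exact: (beta_gt0 PP).
Qed.

(** Inside the closed orthant the weighted-l1 term is linear along [d], so the majorizing model
    changes by its slope plus the curvature of [f]; the unbounded second derivative of [r] never
    enters. *)
Lemma qp_descent x e W d (a L : R) : (forall i, 0 < e 0 i) ->
  (forall i, i \in W -> x 0 i != 0) -> supported W d ->
  closed_orthant x (x + a *: d) ->
  f (x + a *: d) <= f x + dot (grad f x) (a *: d) + L * dot (a *: d) (a *: d) ->
  Fe e (x + a *: d) <= Fe e x + a * dot (qp_grad lam f r x e W) d +
    L * (a ^+ 2 * dot d d).
Proof.
move=> e0 Wx sd cl fL.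
have := Feps_majorize (f := f) lam_gt0 rP x (x + a *: d) e e0.
rewrite /Gmodel => maj.
have S : dot (grad f x) (a *: d) + (\sum_(i < n) weight lam r x e 0 i * `|(x + a *: d) 0 i| -
     \sum_(i < n) weight lam r x e 0 i * `|x 0 i|) = a * dot (qp_grad lam f r x e W) d.
  rewrite -sumrB dotZr /dot !mulr_sumr -big_split; apply: eq_bigr => i _ /=.
  rewrite qp_gradE // [grad f x 0 i]mxE; case: ifP => [iW|/negbT iW]; last first.
    have di : d 0 i = 0 by exact: sd.
    have -> : (x + a *: d) 0 i = x 0 i by rewrite !mxE di mulr0 addr0.
    by rewrite di subrr !mulr0 addr0.
  have -> : `|(x + a *: d) 0 i| = Num.sg (x 0 i) * (x + a *: d) 0 i.
    by rewrite -[RHS]ger0_norm ?cl // normrM normr_sg Wx // mul1r.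
  by rewrite orthant_lineE; ring.
have E2 : dot (a *: d) (a *: d) = a ^+ 2 * dot d d by rewrite dotZl dotZr mulrA.
by move: fL; rewrite E2 -S; lra.
Qed.

(** The model decrease gives the slope bound in terms of |d|^2, and the reference direction gives
    one in terms of |g|^2 / M. Young's inequality turns them into the comparisons of |d| with
    |g|. *)
Lemma qp_direction_bounds (mu M : R) z x e W d : 0 < mu -> 0 < M ->
  (forall d, supported W d -> mu * norm2 d ^+ 2 <= qform (qp_hess lam f r z x e W) d
     <= M * norm2 d ^+ 2) ->
  qp_direction lam f r z x e W d ->
  let g := qp_grad lam f r x e W in
  [/\ dot g d <= - (mu / 2 * dot d d),
      dot d d <= 4 / mu ^+ 2 * dot g g &
      dot g g <= M ^+ 2 * dot d d].
Proof.
move=> mu0 M0 H [sd dref mod] g.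
have sg : supported W g by move=> i /negbTE iW; rewrite mxE iW.
have g0 := dot_ge0 g; have d0 := dot_ge0 d.
have gd : dot g d <= - (mu / 2 * dot d d).
  move: mod; rewrite /qp_model -/g.
  have -> : dot g (0 : 'rV[R]_n) = 0 by apply: big1 => i _; rewrite [X in _ * X]mxE mulr0.
  have -> : qform (qp_hess lam f r z x e W) 0 = 0.
    by apply: big1 => i _; rewrite [X in X * _]mxE mul0r.
  have /andP[Hd _] := H d sd; rewrite norm2_sqr in Hd; lra.
have gr : dot g d <= - (M^-1 * dot g g).
  apply: le_trans dref _; rewrite -/g /qp_ref -/g dotZr mulNr lerN2.
  have /andP[Hl Hu] := H g sg; rewrite norm2_sqr in Hl Hu *.
  have [gg|gg] := eqVneq (dot g g) 0; first by rewrite gg !mulr0.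
  have gp : 0 < dot g g by rewrite lt_neqAle eq_sym gg.
  have qp : 0 < qform (qp_hess lam f r z x e W) g.
    by apply: lt_le_trans Hl; rewrite mulr_gt0.
  rewrite ler_pM2r // ler_pdivlMr // mulrC -ler_pdivlMr ?invr_gt0 // invrK mulrC //.
have Ng : dot g d = - dot (- g) d by rewrite -[- g]scaleN1r dotZl mulN1r opprK.
have Ngg : dot (- g) (- g) = dot g g.
  by rewrite -[- g]scaleN1r dotZl dotZr !mulN1r opprK.
split=> //.
(* With this parameter the |d|^2 term of Young's inequality is half of what the slope bound
   provides, so it can be absorbed. *)
- have mi0 : 0 < 2 / mu by rewrite divr_gt0.
  have := dot_young (2 / mu) (- g) d mi0; rewrite Ngg invf_div => y.
  have h : mu / 2 * dot d d <= 2 / mu * dot g g by lra.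
  have -> : 4 / mu ^+ 2 * dot g g = 2 / mu * (2 / mu * dot g g).
    by field; rewrite gt_eqF.
  by rewrite -ler_pdivrMl // invf_div.
- have Mi0 : 0 < M^-1 by rewrite invr_gt0.
  have := dot_young M^-1 (- g) d Mi0; rewrite Ngg invrK => y.
  have h : M^-1 * dot g g <= M * dot d d by lra.
  by rewrite expr2 -mulrA -ler_pdivrMl.
Qed.

Lemma qp_step_controls_ist (mu M rad rho bmin : R) : 0 < mu -> 0 < bmin ->
  exists2 C : R, 0 <= C &
  forall x e W j d xt z, box rad x -> (forall i, 0 < e 0 i) ->
    working_set lam f r P x e W -> bmin <= beta j ->
    let xhat := ist_trial lam f r P x e W j in
    box rho xhat -> sgnv xhat = sgnv x ->
    (forall d, supported W d ->
      mu * norm2 d ^+ 2 <= qform (qp_hess lam f r z x e W) d <= M * norm2 d ^+ 2) ->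
    qp_direction lam f r z x e W d -> line_search lam f r P x e d xt ->
    sgnv xt = sgnv x ->
    dot (xhat - x) (xhat - x) <= C * dot (xt - x) (xt - x).
Proof.
move=> mu0 bmin0.
have [_ [_ _ /andP[ga0 ga1]] [_ _ xa0] [bb0 _] _] := PP.
(* [B] bounds |g|^2: [beta j] times [g] is the difference of two points in boxes of radii [rad] and
   [rho], and [beta j] is at least [bmin]. *)
pose B : R := n%:R * ((rad + rho) / bmin) ^+ 2.
(* [D] bounds each |d_i|, since t^2 <= K implies t <= K + 1. *)
pose D : R := 4 / mu ^+ 2 * B + 1.
have B0 : 0 <= B by rewrite mulr_ge0 // sqr_ge0.
have D1 : 1 <= D by rewrite lerDr mulr_ge0 // divr_ge0 // sqr_ge0.
have [L L0 LP] := descent_lemma fC2 (rad + D).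
(* A step [a] gains at least [a * mu / 2] times |d|^2; curvature and the acceptance margin cost
   [a ^+ 2 * (L + xi_alpha P / 2)] times |d|^2. Up to [astar] the gain prevails. *)
pose astar := mu / 2 / (L + xi_alpha P / 2).
have Lx0 : 0 < L + xi_alpha P / 2 by rewrite addr_gt0 // divr_gt0.
have as0 : 0 < astar by rewrite !divr_gt0.
pose amin := Num.min 1 (gam_alpha P * astar).
have am0 : 0 < amin by rewrite lt_min ltr01 mulr_gt0.
(* A larger upper bound on the Hessian that is certainly positive. *)
pose M1 := Num.max M 1.
have M10 : 0 < M1 by rewrite lt_max ltr01 orbT.
(* The IST displacement is at most [beta_bar P * M1] times |d|, and the QP displacement is at least
   [amin] times |d|. *)
exists (beta_bar P ^+ 2 * (M1 ^+ 2 * (amin ^+ 2)^-1)).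
  by rewrite mulr_ge0 ?sqr_ge0 // mulr_ge0 ?invr_ge0 ?sqr_ge0.
move=> x e W j d xt z bx e0 WP bj xhat bxh s H dP ls st.
set g := qp_grad lam f r x e W.
have b0 := beta_gt0 PP j.
have bbj : beta j <= beta_bar P.
  by have := beta_homo PP 0 j (leq0n j); rewrite mulr1.
have Wx := same_sign_working_set _ _ _ _ e0 WP s.
have xg : xhat - x = - beta j *: g by exact: ist_step_gradient.
have sd : supported W d by case: dP.
have sdx i : x 0 i = 0 -> d 0 i = 0.
  by move=> xi; apply: sd; apply: contra_eqN xi => /Wx.
have {}H d' : supported W d' -> mu * norm2 d' ^+ 2 <= qform (qp_hess lam f r z x e W) d'
     <= M1 * norm2 d' ^+ 2.
  move=> /H /andP[-> /le_trans]; apply.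
  by rewrite ler_wpM2r ?sqr_ge0 // le_max lexx.
have [gd dg gdd] := qp_direction_bounds mu M1 z x e W d mu0 M10 H dP.
rewrite -/g in gd dg gdd.
have gB : dot g g <= B.
  rewrite /B mulr_natl -[n in _ *+ n]card_ord -sumr_const; apply: ler_sum => i _.
  rewrite -expr2 -[leLHS]real_normK ?num_real // lerXn2r ?nnegrE //.
    by rewrite divr_ge0 ?(ltW bmin0) // addr_ge0 // (le_trans _ (bx i), le_trans _ (bxh i)).
  rewrite ler_pdivlMr // (le_trans (ler_wpM2l (normr_ge0 _) bj)) //.
  rewrite -(gtr0_norm b0) -normrM mulrC -normrN -mulNr.
  have /rowP/(_ i) := xg; rewrite [RHS]mxE => <-.
  rewrite mxE [(- x) 0 i]mxE [rad + rho]addrC (le_trans (ler_normD _ _)) // normrN.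
  exact: lerD (bxh i) (bx i).
have dD i : `|d 0 i| <= D.
  have := dot_ge_coord d i.
  have : dot d d <= 4 / mu ^+ 2 * B.
    by apply: le_trans dg _; rewrite ler_wpM2l // divr_ge0 // sqr_ge0.
  rewrite -(real_normK (num_real (d 0 i))) /D; move: (_ * B) `|d 0 i| => K t; nra.
have small a : 0 < a <= 1 -> a <= astar -> closed_orthant x (x + a *: d) ->
    Fe e (x + a *: d) <= Fe e x - xi_alpha P / 2 * norm2 (a *: d) ^+ 2.
  move=> /andP[a0 a1] aa cl.
  have D0 : 0 <= D by rewrite (le_trans ler01).
  have bx1 : box (rad + D) x by move=> i; rewrite (le_trans (bx i)) // lerDl.
  have bx2 : box (rad + D) (x + a *: d).
    move=> i; rewrite mxE (le_trans (ler_normD _ _)) // lerD // mxE normrM gtr0_norm //.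
    by rewrite (le_trans _ (dD i)) // ler_piMl.
  have := LP _ _ bx1 bx2; rewrite [_ + _ - x]addrC addKr.
  move=> /(qp_descent _ _ _ _ _ _ e0 Wx sd cl) /le_trans; apply.
  have E2 : norm2 (a *: d) ^+ 2 = a * (a * dot d d) by rewrite norm2_sqr dotZl dotZr.
  rewrite E2 -/g -addrA lerD2l.
  have h1 : a * dot g d <= a * - (mu / 2 * dot d d) by rewrite ler_wpM2l // ltW.
  have h2 : a * (L + xi_alpha P / 2) <= mu / 2 by rewrite -ler_pdivlMr.
  have h3 := ler_wpM2l (mulr_ge0 (ltW a0) (dot_ge0 d)) h2.
  by move: h1 h3; rewrite expr2; lra.
have [a /andP[aa a1] xtE] := line_search_step _ _ _ _ _ sdx small ls st.
have a0 : 0 < a by exact: lt_le_trans aa.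
rewrite xg xtE [_ + _ - x]addrC addKr !(dotZl, dotZr).
have h : dot d d <= (amin ^+ 2)^-1 * (a * (a * dot d d)).
  rewrite ler_pdivlMl ?exprn_gt0 // mulrA -expr2 ler_wpM2r ?dot_ge0 //.
  by rewrite lerXn2r // nnegrE ltW.
have -> : - beta j * (- beta j * dot g g) = beta j ^+ 2 * dot g g by ring.
rewrite -[leRHS]mulrA -[X in _ <= _ * X]mulrA.
apply: ler_pM; rewrite ?sqr_ge0 ?dot_ge0 //.
  by rewrite lerXn2r // nnegrE ltW.
by apply: le_trans gdd _; rewrite ler_wpM2l // sqr_ge0.
Qed.

End QuadraticStep.

(** * Convergence to 0 and cluster points of sequences *)

Section Sequences.
Context {R : realType} {n : nat}.

Lemma nonincreasing_diff_cvg0 (u : nat -> R) (m : R) :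
  (forall k, u k.+1 <= u k) -> (forall k, m <= u k) ->
  u k - u k.+1 @[k --> \oo] --> (0 : R).
Proof.
move=> uS um.
have cu : cvgn u.
  apply: nonincreasing_is_cvgn; first exact/nonincreasing_seqP.
  by exists m => _ [k _ <-].
rewrite -(subrr (limn u)); apply: cvgB => //.
by rewrite (cvg_shiftS u).
Qed.

Lemma norm2_cvg0 (u : nat -> 'rV[R]_n) (delta : nat -> R) (C : R) :
  delta k @[k --> \oo] --> (0 : R) ->
  (forall k, dot (u k) (u k) <= C * delta k) ->
  norm2 (u k) @[k --> \oo] --> (0 : R).
Proof.
move=> d0 ud.
have cd : C * delta k @[k --> \oo] --> (0 : R).
  by rewrite -(mulr0 C); apply: cvgM => //; exact: cvg_cst.
have cu : dot (u k) (u k) @[k --> \oo] --> (0 : R).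
  apply: squeeze_cvgr (cvg_cst 0) cd.
  by near=> k; rewrite dot_ge0 ud.
rewrite -(@sqrtr0 R).
apply: (@continuous_cvg _ _ _ _ _ (fun k => dot (u k) (u k)) (@Num.sqrt R)) => //.
exact: sqrt_continuous.
Unshelve. all: by end_near. Qed.

(** Replaces the extraction of a subsequence: a single index realizes an eventual property together
    with a property near the cluster point. *)
Lemma cluster_seq_ex (x : nat -> 'rV[R]_n) (xs : 'rV[R]_n)
    (Q : nat -> Prop) (B : 'rV[R]_n -> Prop) :
  cluster (x @ \oo) xs -> (\forall k \near \oo, Q k) ->
  (\forall y \near xs, B y) -> exists2 k, Q k & B (x k).
Proof.
move=> cl Qk By.
have [|_ [[k Qk' <-] Bxk]] := cl [set x k | k in Q] _ _ By; last by exists k.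
by apply: filterS Qk => k Qk'; exists k.
Qed.

End Sequences.

(** * Decrease of the values along a run and vanishing residuals *)

Section Run.
Context {R : realType} {n : nat} {lam : R} {f : 'rV[R]_n -> R} {r : R -> R}.
Context {P : irena_params R} {x e : nat -> 'rV[R]_n}.
Context {W : nat -> {set 'I_n}} {xhat : nat -> 'rV[R]_n} {rad Lf mu M : R}.
Context (lam_gt0 : 0 < lam) (fC2 : C2 f) (rP : regularizer r).
Context (PP : admissible P) (run : irena_run lam f r P 0 x e W xhat).
Context (standing : standing_assumption lam f r (x 0%N) (e 0%N) rad Lf).
Context (mu_gt0 : 0 < mu) (hess : qp_hess_bounded lam f r P mu M x e W xhat).

Local Notation Fe := (Feps lam f r).
Local Notation G := (Gmodel lam f r).
Local Notation V k := (Fe (e k) (x k)).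

Lemma eps_gt0 k i : 0 < e k 0 i.
Proof.
have [e0 st] := run; elim: k => [//|k IH].
have [_ _ _ _ /(_ i) [h1 h2]] := st k.
have [xi|xi] := eqVneq (x k.+1 0 i) 0; first by rewrite h2.
by have /andP[] := h1 xi.
Qed.

Lemma eps_nonincreasing k i : e k.+1 0 i <= e k 0 i.
Proof.
have [_ /(_ k) [_ _ _ _ /(_ i) [h1 h2]]] := run.
have [_ [/andP[g0 g1] _ _] _ _ _] := PP.
have [xi|xi] := eqVneq (x k.+1 0 i) 0; first by rewrite h2.
have /andP[_ /ltW /le_trans] := h1 xi; apply.
by rewrite ler_piMl // ltW // eps_gt0.
Qed.

Lemma value_le k : V k.+1 <= Fe (e k) (x k.+1).
Proof.
apply: Feps_le => // i.
by rewrite eps_nonincreasing ltW // eps_gt0.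
Qed.

Lemma ist_decrease k : Fe (e k) (xhat k) <= V k -
    xi_beta P / 2 * dot (xhat k - x k) (xhat k - x k).
Proof.
have [_ /(_ k) [_ _ [j [jacc _ xE]] _ _]] := run.
have := Feps_majorize (f := f) lam_gt0 rP (x k) (xhat k) (e k) (eps_gt0 k).
by move: jacc; rewrite /ist_accept norm2_sqr -xE; lra.
Qed.

(** The first case merges a sign change of the IST point with the rejection of the QP point in step
    4(c). *)
Lemma next_cases k :
  x k.+1 = xhat k \/
  [/\ sgnv (xhat k) = sgnv (x k),
    exists2 d, qp_direction lam f r (zeta P k) (x k) (e k) (W k) d
      & line_search lam f r P (x k) (e k) d (x k.+1) &
    sgnv (x k.+1) = sgnv (x k) \/
    nu P * (G (x k) (e k) (x k) - G (x k) (e k) (xhat k)) <=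
      V k - Fe (e k) (x k.+1)].
Proof.
have [_ /(_ k) [_ _ _ nx _]] := run; move: nx; rewrite /next_iterate.
case: eqVneq => [s /= [_ [d [xt [dP ls]]]]|_ /=]; last by left.
case: ifP => [_|/negbT]; first by left.
move=> h xE; right; split=> //; first by exists d; rewrite ?xE.
move: h; rewrite negb_and negbK xE => /orP[/eqP ->|]; first by left.
by rewrite -leNgt; right.
Qed.

Lemma line_search_decrease k d xt :
  line_search lam f r P (x k) (e k) d xt ->
  Fe (e k) xt <= V k - xi_alpha P / 2 * dot (xt - x k) (xt - x k).
Proof. by case=> j [jacc _ ->]; rewrite -norm2_sqr. Qed.

Lemma value_nonincreasing k : V k.+1 <= V k.
Proof.
have [_ _ [_ xb xa] _ _] := PP.
apply: le_trans (value_le k) _; case: (next_cases k) => [->|[_ [d _ ls] _]].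
  by apply: le_trans (ist_decrease k) _; rewrite gerBl mulr_ge0 ?dot_ge0 // divr_ge0 // ltW.
apply: le_trans (line_search_decrease _ _ _ ls) _.
by rewrite gerBl mulr_ge0 ?dot_ge0 // divr_ge0 // ltW.
Qed.

(** F(x^k) <= F(x^k; eps^k) <= F(x^0; eps^0) keeps the iterates in the level set. *)
Lemma iterate_box k : box rad (x k).
Proof.
have [lev _ _ _] := standing => i.
apply: le_trans (norm2_ge_coord _ i) (lev _ _).
rewrite /level_set /=; apply: (@le_trans _ _ (V k)).
  by apply: F_le_Feps => //; exact: eps_gt0.
by elim: k => [//|k]; apply: le_trans (value_nonincreasing k).
Qed.

Lemma value_drop_cvg0 : V k - V k.+1 @[k --> \oo] --> (0 : R).
Proof.
have [_ [m mP] _ _] := standing.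
apply: (nonincreasing_diff_cvg0 _ m value_nonincreasing) => k.
by apply: le_trans (mP (x k)) _; apply: F_le_Feps => //; exact: eps_gt0.
Qed.

Lemma step_le_value_drop : exists C : R, forall k,
  dot (x k.+1 - x k) (x k.+1 - x k) <= C * (V k - V k.+1).
Proof.
have [_ _ [_ xb xa] _ _] := PP.
exists ((xi_beta P / 2)^-1 + (xi_alpha P / 2)^-1) => k.
have b0 : 0 < xi_beta P / 2 by rewrite divr_gt0.
have a0 : 0 < xi_alpha P / 2 by rewrite divr_gt0.
have D0 : 0 <= V k - V k.+1 by rewrite subr_ge0 value_nonincreasing.
have vl := value_le k.
rewrite mulrDl; case: (next_cases k) => [xE|[_ [d _ ls] _]].
  rewrite ler_wpDr //; first by rewrite mulr_ge0 // invr_ge0 ltW.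
  by rewrite ler_pdivlMl //; have := ist_decrease k; rewrite -xE; lra.
rewrite ler_wpDl //; first by rewrite mulr_ge0 // invr_ge0 ltW.
by rewrite ler_pdivlMl //; have := line_search_decrease _ _ _ ls; lra.
Qed.

Lemma residual_le_value_drop : exists C : R, forall k,
  dot (Phi lam f r (x k) (e k)) (Phi lam f r (x k) (e k)) +
  dot (Psi lam f r (x k) (e k)) (Psi lam f r (x k) (e k)) <= C * (V k - V k.+1).
Proof.
have [_ _ [_ xb xa] [_ nu0] _] := PP.
have [bmin [C1 [rho [bmin0 C10 ist]]]] :=
  ist_controls_residual (f := f) lam_gt0 fC2 rP PP rad.
have [C2 C20 qp] :=
  qp_step_controls_ist (f := f) lam_gt0 fC2 rP PP mu M rad rho bmin mu_gt0 bmin0.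
have b0 : 0 < xi_beta P / 2 by rewrite divr_gt0.
have a0 : 0 < xi_alpha P / 2 by rewrite divr_gt0.
have nb0 : 0 < nu P * (xi_beta P / 2) by rewrite mulr_gt0.
(* One summand per case: the IST point is taken, a QP point passes the [nu] test, or a QP point
   keeps the signs. *)
exists (C1 * ((xi_beta P / 2)^-1 + ((nu P * (xi_beta P / 2))^-1 +
  C2 * (xi_alpha P / 2)^-1))) => k.
have D0 : 0 <= V k - V k.+1 by rewrite subr_ge0 value_nonincreasing.
have vl := value_le k.
have [_ /(_ k) [_ WP istk _ _]] := run.
have bx := iterate_box k; have e0 := eps_gt0 k.
have [j [xE jacc bj bxh res]] := ist _ _ _ _ bx e0 WP istk.
apply: le_trans res _; rewrite -[leRHS]mulrA ler_wpM2l // !mulrDl.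
set D := V k - V k.+1 in D0 *.
have p1 : 0 <= (xi_beta P / 2)^-1 * D by rewrite mulr_ge0 // invr_ge0 ltW.
have p2 : 0 <= (nu P * (xi_beta P / 2))^-1 * D by rewrite mulr_ge0 // invr_ge0 ltW.
have p3 : 0 <= C2 * (xi_alpha P / 2)^-1 * D.
  by rewrite mulr_ge0 // mulr_ge0 // invr_ge0 ltW.
case: (next_cases k) => [xS|[s [d dP ls] [sx|big]]].
- rewrite (ler_wpDr (addr_ge0 p2 p3)) // ler_pdivlMl //.
  by have := ist_decrease k; rewrite -xS /D; lra.
- rewrite (ler_wpDl p1) // (ler_wpDl p2) //.
  have := qp _ _ _ j d (x k.+1) (zeta P k) bx e0 WP bj.
  rewrite -xE => /(_ bxh s (hess k s) dP ls sx) /le_trans; apply.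
  rewrite -mulrA ler_wpM2l // ler_pdivlMl //.
  by have := line_search_decrease _ _ _ ls; rewrite /D; lra.
- rewrite (ler_wpDl p1) // (ler_wpDr p3) // ler_pdivlMl // -mulrA.
  apply: (@le_trans _ _ (nu P * (G (x k) (e k) (x k) - G (x k) (e k) (xhat k)))).
    rewrite ler_pM2l //; move: jacc; rewrite /ist_accept -xE norm2_sqr; lra.
  by apply: le_trans big _; rewrite /D; lra.
Qed.

Lemma step_cvg0 : norm2 (x k.+1 - x k) @[k --> \oo] --> (0 : R).
Proof. by have [C] := step_le_value_drop; exact: norm2_cvg0 value_drop_cvg0. Qed.

Lemma Phi_cvg0 : norm2 (Phi lam f r (x k) (e k)) @[k --> \oo] --> (0 : R).
Proof.
have [C CP] := residual_le_value_drop.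
apply: (norm2_cvg0 _ _ C value_drop_cvg0) => k.
by apply: le_trans (CP k); rewrite lerDl dot_ge0.
Qed.

Lemma Psi_cvg0 : norm2 (Psi lam f r (x k) (e k)) @[k --> \oo] --> (0 : R).
Proof.
have [C CP] := residual_le_value_drop.
apply: (norm2_cvg0 _ _ C value_drop_cvg0) => k.
by apply: le_trans (CP k); rewrite lerDr dot_ge0.
Qed.

Lemma eps_le0 k i : e k 0 i <= e 0%N 0 i.
Proof. by elim: k => [//|k]; apply: le_trans (eps_nonincreasing k i). Qed.

(** The sum of the entries of eps decreases and converges, although some entries may keep a positive
    limit. Each entry drops by at most the initial sum [s 0%N], so the squared step is at most
    [s 0%N] times the drop of the sum. *)
Lemma eps_step_cvg0 : norm2 (e k.+1 - e k) @[k --> \oo] --> (0 : R).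
Proof.
pose s k := \sum_i e k 0 i.
have sd : s k - s k.+1 @[k --> \oo] --> (0 : R).
  apply: (nonincreasing_diff_cvg0 _ 0) => k.
    by apply: ler_sum => i _; exact: eps_nonincreasing.
  by apply: sumr_ge0 => i _; rewrite ltW // eps_gt0.
apply: (norm2_cvg0 _ _ (s 0%N) sd) => k.
rewrite /s -sumrB mulr_sumr; apply: ler_sum => i _; rewrite !mxE.
have := eps_nonincreasing k i; have := eps_gt0 k.+1 i; have := eps_le0 k i.
have : e 0%N 0 i <= \sum_i e 0%N 0 i.
  by rewrite (bigD1 i) //= lerDl sumr_ge0 // => l _; rewrite ltW // eps_gt0.
move: (e k.+1 0 i) (e k 0 i) (e 0%N 0 i) (\sum__ _) => a b c S; nra.
Qed.

(** A positive limit l is impossible: once the entry is below [l / gam_eps P], the next update at a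
    nonzero coordinate brings it below l, against monotonicity. *)
Lemma eps_cvg0 i : (forall K, exists2 k, (K <= k)%N & x k 0 i != 0) ->
  e k 0 i @[k --> \oo] --> (0 : R).
Proof.
move=> freq; pose u k := e k 0 i.
have [_ [/andP[g0 g1] _ _] _ _ _] := PP.
have un : nonincreasing_seq u by apply/nonincreasing_seqP => k; exact: eps_nonincreasing.
have cu : cvgn u.
  apply: nonincreasing_is_cvgn => //.
  by exists 0 => _ [k _ <-]; rewrite ltW // eps_gt0.
have ul k : limn u <= u k by exact: nonincreasing_cvgn_ge.
have l0 : 0 <= limn u.
  by apply: limr_ge => //; near=> k; rewrite ltW // eps_gt0.
have [l00|ln0] := eqVneq (limn u) 0; first by rewrite -l00.
have lp : 0 < limn u by rewrite lt_neqAle eq_sym ln0.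
have lg : limn u < limn u / gam_eps P by rewrite ltr_pdivlMr // gtr_pMr.
have [K _ hK] := cvgr_lt _ cu _ lg.
(* The shift makes the index a successor [k.+1] with [k] at least [K], since contraction from [e k]
   is governed by [x k.+1]. *)
have [[|k] // Kk xk] := freq K.+1.
have [_ /(_ k) [_ _ _ _ /(_ i) [/(_ xk) /andP[_ h] _]]] := run.
have := hK k Kk; rewrite /= ltr_pdivlMr // mulrC => h'.
by have := lt_trans h h'; rewrite ltNge ul.
Unshelve. all: by end_near. Qed.

End Run.

(** * First-order stationarity of cluster points *)

Section Stationarity.
Context {R : realType} {n : nat} {lam : R} {f : 'rV[R]_n -> R} {r : R -> R}.
Context {P : irena_params R} {x e : nat -> 'rV[R]_n}.
Context {W : nat -> {set 'I_n}} {xhat : nat -> 'rV[R]_n} {rad Lf mu M : R}.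
Context (lam_gt0 : 0 < lam) (fC2 : C2 f) (rP : regularizer r).
Context (PP : admissible P) (run : irena_run lam f r P 0 x e W xhat).
Context (standing : standing_assumption lam f r (x 0%N) (e 0%N) rad Lf).
Context (mu_gt0 : 0 < mu) (hess : qp_hess_bounded lam f r P mu M x e W xhat).
Context {xs : 'rV[R]_n} (xsP : cluster (x @ \oo) xs).

Lemma partial_near i (eta : R) : 0 < eta ->
  \forall y \near xs, `|partial f i xs - partial f i y| < eta.
Proof.
move=> eta0; have := grad_continuous fC2 i xs.
move=> /cvgrPdist_lt/(_ _ eta0); apply: filterS => y.
by rewrite !mxE.
Qed.

Lemma residuals_near i (eta : R) : 0 < eta -> \forall k \near \oo,
  `|phi1 (x k 0 i) (partial f i (x k)) (weight lam r (x k) (e k) 0 i)| < eta /\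
  `|psi1 (x k 0 i) (partial f i (x k)) (weight lam r (x k) (e k) 0 i)| < eta.
Proof.
move=> eta0.
have /cvgrPdist_lt/(_ _ eta0) p := Phi_cvg0 lam_gt0 fC2 rP PP run standing mu_gt0 hess.
have /cvgrPdist_lt/(_ _ eta0) s := Psi_cvg0 lam_gt0 fC2 rP PP run standing mu_gt0 hess.
near=> k; rewrite -PhiE -PsiE; split; apply: le_lt_trans (norm2_ge_coord _ i) _.
  by rewrite -[norm2 _]ger0_norm ?norm2_ge0 // -normrN -sub0r; near: k.
by rewrite -[norm2 _]ger0_norm ?norm2_ge0 // -normrN -sub0r; near: k.
Unshelve. all: by end_near. Qed.

(** Every weight is at most [lam * D], because [derive1 r] stays below its limit at 0; the rest of
    [multiplier_bound] is residuals that vanish. *)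
Lemma stationary_zero i (D : R) : dr0 r = D%:E -> `|partial f i xs| <= lam * D.
Proof.
move=> rD; apply/ler_addgt0Pr => eta eta0.
have h0 : 0 < eta / 3 by rewrite divr_gt0.
have [k [h1 h2] h3] := cluster_seq_ex _ _ _ _ xsP (residuals_near i _ h0) (partial_near i _ h0).
have e0 := eps_gt0 run k i.
have w0 := weight_gt0 lam_gt0 rP (x k) (e k) i e0.
have := multiplier_bound (x k 0 i) (partial f i (x k)) _ w0.
have : weight lam r (x k) (e k) 0 i <= lam * D.
  rewrite mxE ler_pM2l // -lee_fin -rD; apply: (derive1_le_dr0 rP).
  by rewrite ltr_wpDl.
have := ler_normD (partial f i xs - partial f i (x k)) (partial f i (x k)).
rewrite subrK; lra.
Qed.

Lemma near_coord i (eta : R) : 0 < eta ->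
  \forall y \near xs, `|xs 0 i - (y : 'rV[R]_n) 0 i| < eta.
Proof. by move=> eta0; have /cvgrPdist_lt/(_ _ eta0) := @coord_continuous R 1 n 0 i xs. Qed.

Lemma near_sg i : xs 0 i != 0 ->
  \forall y \near xs, Num.sg ((y : 'rV[R]_n) 0 i) = Num.sg (xs 0 i) /\ `|xs 0 i| / 2 < `|y 0 i|.
Proof.
move=> xi; have h0 : 0 < `|xs 0 i| / 2 by rewrite divr_gt0 // normr_gt0.
apply: filterS (near_coord i _ h0) => y.
have [p|p] := ltP 0 (xs 0 i).
  rewrite (gtr0_norm p) ltr_norml => /andP[h1 h2].
  have yp : 0 < y 0 i by lra.
  by rewrite !gtr0_sg // gtr0_norm //; split; lra.
have {}p : xs 0 i < 0 by rewrite lt_neqAle xi.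
rewrite (ltr0_norm p) ltr_norml => /andP[h1 h2].
have yp : y 0 i < 0 by lra.
by rewrite !ltr0_sg // ltr0_norm //; split; lra.
Qed.

(** The coordinate is nonzero infinitely often, so its eps tends to 0 and the weight approaches
    [lam * derive1 r] at the limit, by continuity of [derive1 r] there. *)
Lemma stationary_nonzero i : xs 0 i != 0 ->
  partial f i xs + lam * (derive1 r `|xs 0 i| * Num.sg (xs 0 i)) = 0.
Proof.
move=> xi.
have xp : 0 < `|xs 0 i| by rewrite normr_gt0.
have e0 : e k 0 i @[k --> \oo] --> (0 : R).
  apply: (eps_cvg0 PP run) => K.
  have [k Kk [_ hk]] := cluster_seq_ex _ _ _ _ xsP (nbhs_infty_ge K) (near_sg i xi).
  by exists k => //; rewrite -normr_gt0 (le_lt_trans _ hk) // ltW // divr_gt0.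
have rc : {for `|xs 0 i|, continuous (derive1 r)}.
  have [_ _ dr _ _] := rP; have [_ d2 _] := dr _ (lt0r_neq0 xp).
  exact/differentiable_continuous/derivable1_diffP.
apply/eqP; rewrite -normr_eq0 eq_le normr_ge0 andbT.
apply/ler_addgt0Pr => eta eta0; rewrite add0r.
have h0 : 0 < eta / 3 by rewrite divr_gt0.
have hl : 0 < eta / 3 / lam by rewrite divr_gt0.
have /cvgrPdist_lt/(_ _ hl)/nbhs_ballP[del /= del0 hdel] := rc.
have d20 : 0 < del / 2 by rewrite divr_gt0.
(* The second bound keeps Phi_i below |x_i|, so that [phi1_grad] identifies its modulus with that of
   the partial derivative. *)
have m0 : 0 < Num.min (eta / 3) (`|xs 0 i| / 2) by rewrite lt_min h0 divr_gt0.
have evQ : \forall k \near \oo,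
   `|phi1 (x k 0 i) (partial f i (x k)) (weight lam r (x k) (e k) 0 i)| <
     Num.min (eta / 3) (`|xs 0 i| / 2) /\ e k 0 i < del / 2.
  near=> k; split; last by near: k; exact: (cvgr_lt _ e0).
  by near: k; apply: filterS (residuals_near i _ m0) => k [].
have evB : \forall y \near xs, [/\ `|partial f i xs - partial f i y| < eta / 3,
    `|xs 0 i - y 0 i| < del / 2 & Num.sg (y 0 i) = Num.sg (xs 0 i) /\
    `|xs 0 i| / 2 < `|y 0 i|].
  near=> y; split; near: y; [exact: partial_near|exact: near_coord|exact: near_sg].
have [k [hphi he] [hp hx [hs hx2]]] := cluster_seq_ex _ _ _ _ xsP evQ evB.
have ek0 := eps_gt0 run k i.
have w0 := weight_gt0 lam_gt0 rP (x k) (e k) i ek0.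
move: hphi; rewrite lt_min => /andP[hphi hphi2].
have xk0 : x k 0 i != 0 by rewrite -normr_gt0 (lt_trans _ hx2) // divr_gt0.
have := phi1_grad _ (partial f i (x k)) _ w0 xk0 (lt_trans hphi2 hx2).
rewrite hs => E.
have hr : `|derive1 r `|xs 0 i| - derive1 r (`|x k 0 i| + e k 0 i)| < eta / 3 / lam.
  apply: hdel; rewrite /ball /=; apply: (@le_lt_trans _ _ (`|xs 0 i - x k 0 i| + e k 0 i)).
    rewrite opprD addrA (le_trans (ler_normB _ _)) // (gtr0_norm ek0) lerD2r.
    exact: ler_dist_dist.
  by rewrite (splitr del) ltrD.
set g := partial f i (x k) in hp E hphi.
set a := derive1 r `|xs 0 i| in hr *.
set b := derive1 r (`|x k 0 i| + e k 0 i) in hr.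
set s := Num.sg (xs 0 i) in E *.
have wE : weight lam r (x k) (e k) 0 i = lam * b by rewrite mxE.
rewrite -E wE in hphi.
(* Three errors of at most [eta / 3]: continuity of the gradient of [f], the residual, and
   continuity of [derive1 r]. *)
have -> : partial f i xs + lam * (a * s) =
    (partial f i xs - g) + (g + lam * b * s) + lam * (a - b) * s by ring.
have s1 : `|s| = 1 by rewrite normr_sg xi.
have h4 : `|lam * (a - b) * s| < eta / 3.
  by rewrite !normrM s1 mulr1 gtr0_norm // mulrC -ltr_pdivlMr.
apply: le_trans (ler_normD _ _) _.
have := ler_normD (partial f i xs - g) (g + lam * b * s); lra.
Unshelve. all: by end_near. Qed.

Lemma cluster_stationary : stationary lam f r xs.
Proof.
move=> i; rewrite /subdiff; case: eqVneq => [xi|xi]; last first.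
  exists (derive1 r `|xs 0 i| * Num.sg (xs 0 i)) => //.
  exact: stationary_nonzero.
exists (- partial f i xs / lam); last by rewrite mulrC divfK ?gt_eqF // subrr.
(* Comparison with the finite slope at 1 excludes [dr0 r] = -oo; if it is +oo, every multiplier is
   admissible. *)
have := derive1_le_dr0 rP 1 ltr01.
case E: (dr0 r) => [D| |] //= h; last by rewrite leNye leey.
have := stationary_zero i D E; rewrite mulrC ler_norml => /andP[h1 h2].
by rewrite !lee_fin ler_pdivlMr // ler_pdivrMr //; split; lra.
Qed.

End Stationarity.

Theorem theorem2 (R : realType) (n : nat)
  (lam : R) (f : 'rV[R]_n -> R) (r : R -> R) (P : irena_params R)
  (x e : nat -> 'rV[R]_n) (W : nat -> {set 'I_n}) (xhat : nat -> 'rV[R]_n)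
  (rad Lf mu M : R) :
  0 < lam -> C2 f -> regularizer r -> admissible P ->
  irena_run lam f r P 0 x e W xhat ->
  standing_assumption lam f r (x 0%N) (e 0%N) rad Lf ->
  0 < mu -> qp_hess_bounded lam f r P mu M x e W xhat ->
  [/\ norm2 (x k.+1 - x k) @[k --> \oo] --> (0 : R),
      norm2 (e k.+1 - e k) @[k --> \oo] --> (0 : R),
      norm2 (Phi lam f r (x k) (e k)) @[k --> \oo] --> (0 : R),
      norm2 (Psi lam f r (x k) (e k)) @[k --> \oo] --> (0 : R)
    & forall xstar, cluster (x @ \oo) xstar -> stationary lam f r xstar].
Proof.
move=> lam0 fC2 rP PP run standing mu0 hess; split.
- exact: (step_cvg0 lam0 rP PP run standing).
- exact: (eps_step_cvg0 PP run).
- exact: (Phi_cvg0 lam0 fC2 rP PP run standing mu0 hess).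
- exact: (Psi_cvg0 lam0 fC2 rP PP run standing mu0 hess).
- by move=> xs; exact: (cluster_stationary lam0 fC2 rP PP run standing mu0 hess).
Qed.
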